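(* Let $S^6\subset\mathbb{R}^7$ be the unit sphere with its standard round metric (with norm $\|\cdot\|$) and Levi-Civita connection $\nabla$. For any almost complex structure $J$ on $S^6$, there is some non-zero tangent vector $X$ at some point of $S^6$ such that $$\operatorname{Im}\operatorname{Tr}\Big([\nabla_XJ,\nabla_{JX}J]\big|_{T^{0,1}}\Big)\ge 2\big(\|X\|^2+\|JX\|^2\big).$$ In particular, there is a unit tangent vector $X$ for which $$\operatorname{Im}\operatorname{Tr}\Big([\nabla_XJ,\nabla_{JX}J]\big|_{T^{0,1}}\Big)\ge 2.$$
   Context: An almost complex structure on a manifold $M$ is a smooth section $J$ of $\operatorname{End}(TM)$ with $J^2=-\operatorname{Id}$. $(\nabla_X J)Y=\nabla_X(JY)-J\nabla_XY$. $T^{0,1}_x=\{v\in T_xM\otimes\mathbb{C}: Jv=-iv\}$. The commutator $[\nabla_XJ,\nabla_YJ]$ (extended $\mathbb{C}$-linearly to $TM\otimes\mathbb{C}$) commutes with $J$, hence preserves $T^{0,1}$; $[\nabla_XJ,\nabla_YJ]|_{T^{0,1}}:T^{0,1}\to T^{0,1}$ denotes its restriction, and $\operatorname{Tr}$ is the complex trace. *)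

(* Defs.v *)
From mathcomp Require Import all_boot all_order all_algebra.
From mathcomp Require Import mxred.
From mathcomp.real_closed Require Import complex.
From mathcomp Require Import all_classical all_reals all_analysis.

Set Implicit Arguments.
Unset Strict Implicit.
Unset Printing Implicit Defensive.

Import Order.TTheory GRing.Theory Num.Theory.
Import numFieldNormedType.Exports.

Local Open Scope classical_set_scope.
Local Open Scope ring_scope.

(* The norm `| . | that the library puts on 'rV[R]_n is the sup norm; it is used
   below only through the topology it induces. Metric quantities are expressed
   with the Euclidean product and norm that follow. *)
Definition dot (R : realType) (n : nat) (u v : 'rV[R]_n) : R :=
  \sum_(i < n) u ord0 i * v ord0 i.

Definition enorm (R : realType) (n : nat) (u : 'rV[R]_n) : R :=
  Num.sqrt (dot u u).

Definition sphere6 (R : realType) : Type :=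
  {x : 'rV[R]_7 | dot x x == 1}.

(* C^oo on an open set: all iterated directional derivatives exist and are
   (Frechet) differentiable, hence continuous, at every point of U. *)
Definition smooth_on (R : realType) (V W : normedModType R) (U : set V)
    (f : V -> W) : Prop :=
  forall (vs : seq V) (x : V), U x ->
    differentiable (foldr (fun v g => 'D_v g) f vs) x.

(* A map on the embedded submanifold S^6 is smooth when it extends locally to
   smooth maps of the ambient space. *)
Definition smooth (R : realType) (W : normedModType R) (f : sphere6 R -> W) :
    Prop :=
  forall x : sphere6 R, exists U : set 'rV[R]_7, exists g : 'rV[R]_7 -> W,
    [/\ open U, U (val x), smooth_on U g &
        forall y : sphere6 R, U (val y) -> f y = g (val y)].

Definition tangent (R : realType) (x : sphere6 R) (v : 'rV[R]_7) : Prop :=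
  dot (val x) v = 0.

(* The differential of f at x applied to v: f is extended off the sphere to be
   constant along rays. The default x of insubd is taken only at y = 0. *)
Definition dS (R : realType) (W : normedModType R) (f : sphere6 R -> W)
    (x : sphere6 R) (v : 'rV[R]_7) : W :=
  'D_v (fun y : 'rV[R]_7 => f (insubd x ((enorm y)^-1 *: y))) (val x).

Definition vector_field (R : realType) (Y : sphere6 R -> 'rV[R]_7) : Prop :=
  smooth Y /\ forall x, tangent x (Y x).

(* nabla x v Y stands for (nabla_v Y)(x), with v tangent at x. *)
Record affine_connection (R : realType)
    (nabla : sphere6 R -> 'rV[R]_7 -> (sphere6 R -> 'rV[R]_7) -> 'rV[R]_7) :
    Prop := {
  connection_tangent : forall x v Y,
    tangent x v -> vector_field Y -> tangent x (nabla x v Y);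
  connection_smooth : forall X Y,
    vector_field X -> vector_field Y -> smooth (fun x => nabla x (X x) Y);
  connection_linear : forall x (a : R) v w Y,
    tangent x v -> tangent x w -> vector_field Y ->
    nabla x (a *: v + w) Y = a *: nabla x v Y + nabla x w Y;
  connection_additive : forall x v Y Z,
    tangent x v -> vector_field Y -> vector_field Z ->
    nabla x v (fun y => Y y + Z y) = nabla x v Y + nabla x v Z;
  connection_Leibniz : forall x v (f : sphere6 R -> R) Y,
    tangent x v -> smooth f -> vector_field Y ->
    nabla x v (fun y => f y *: Y y) = dS f x v *: Y x + f x *: nabla x v Y
}.

Record levi_civita (R : realType)
    (nabla : sphere6 R -> 'rV[R]_7 -> (sphere6 R -> 'rV[R]_7) -> 'rV[R]_7) :
    Prop := {
  levi_civita_connection : affine_connection nabla;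
  levi_civita_metric : forall x v Y Z,
    tangent x v -> vector_field Y -> vector_field Z ->
    dS (fun y => dot (Y y) (Z y)) x v =
      dot (nabla x v Y) (Z x) + dot (Y x) (nabla x v Z);
  (* nabla_X Y - nabla_Y X = [X, Y], both sides acting on functions f *)
  levi_civita_torsion_free : forall x X Y (f : sphere6 R -> R),
    vector_field X -> vector_field Y -> smooth f ->
    dS f x (nabla x (X x) Y - nabla x (Y x) X) =
      dS (fun y => dS f y (Y y)) x (X x) - dS (fun y => dS f y (X y)) x (Y x)
}.

(* Matrices act on row vectors from the right. An endomorphism of T_x S^6 is
   encoded by the matrix that extends it by 0 on the normal line R x; this
   embeds End(T S^6) as a smooth subbundle of the trivial bundle 'M_7. *)
Definition tangent_end (R : realType) (x : sphere6 R) (A : 'M[R]_7) : Prop :=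
  val x *m A = 0 /\ forall v, tangent x v -> tangent x (v *m A).

Record almost_complex_structure (R : realType) (J : sphere6 R -> 'M[R]_7) :
    Prop := {
  acs_smooth : smooth J;
  acs_end : forall x, tangent_end x (J x);
  acs_square : forall x v, tangent x v -> v *m J x *m J x = - v
}.

(* nabla_v J at x: the endomorphism A of T_x S^6 determined by
   A (Y x) = nabla_v (J Y) - J (nabla_v Y) for all vector fields Y. *)
Definition nabla_end (R : realType)
    (nabla : sphere6 R -> 'rV[R]_7 -> (sphere6 R -> 'rV[R]_7) -> 'rV[R]_7)
    (J : sphere6 R -> 'M[R]_7) (x : sphere6 R) (v : 'rV[R]_7) : 'M[R]_7 :=
  xget 0 [set A | tangent_end x A /\ forall Y, vector_field Y ->
    Y x *m A = nabla x v (fun y => Y y *m J y) - nabla x v Y *m J x].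

(* The composite A o B of endomorphisms acting on row vectors is B *m A. *)
Definition commutator_end (R : realType) (A B : 'M[R]_7) : 'M[R]_7 :=
  B *m A - A *m B.

Definition complexify (R : realType) (m n : nat) (A : 'M[R]_(m, n)) :
    'M[R[i]]_(m, n) :=
  map_mx (real_complex R) A.

(* Row space = { v in T_x S^6 (x) C | J v = - i v }. *)
Definition T01 (R : realType) (J : sphere6 R -> 'M[R]_7) (x : sphere6 R) :
    'M[R[i]]_7 :=
  (kermx (complexify (val x))^T :&: eigenspace (complexify (J x)) (- 'i%C))%MS.

Definition trace_T01 (R : realType) (J : sphere6 R -> 'M[R]_7) (x : sphere6 R)
    (A : 'M[R]_7) : R[i] :=
  \tr (restrictmx (T01 J x) (complexify A)).

(* Main.v *)
Require Import Defs.
From mathcomp Require Import all_boot all_order all_algebra.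
From mathcomp Require Import mxred zify ring lra.
From mathcomp.real_closed Require Import complex.
From mathcomp Require Import all_classical all_reals all_analysis.
Set Implicit Arguments.
Unset Strict Implicit.
Unset Printing Implicit Defensive.
Import Order.TTheory GRing.Theory Num.Theory.
Import numFieldNormedType.Exports.
Local Open Scope classical_set_scope.
Local Open Scope ring_scope.

(** Let P be the orthogonal projection of R^7 onto the tangent space, and extend J by
    zero on the normal line. Then Q = (P + iJ) / 2 is a smooth family of idempotents,
    with image T^{0,1}, and the two-form tr (Q [dQ, dQ]) is closed, being the trace of
    the curvature of the connection that Q induces on T^{0,1} from the flat trivial
    bundle. [chern_form] is eight times its imaginary part, written in terms of P and
    J; it is closed by [chern_form_closed]. Splitting dJ into the covariant derivative
    and the second fundamental form of the sphere gives, for T(X) the trace in the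
    theorem, the value [-4 (|X|^2 + |JX|^2) + 2 T(X)] of this form on the pair (X, JX)
    ([chern_alg_tame], [trace_commutator]). If the first inequality failed for every
    nonzero X, the form would be negative on all these pairs, hence nondegenerate: it
    would be a symplectic form on the six-sphere.

    A closed two-form on a six-sphere is exact, so that its cube integrates to zero,
    and it degenerates somewhere. To see this without cohomology, pull the form back
    by [collapse], a map from the cube [0,1]^6 to the sphere that is an immersion
    inside the cube and whose derivative vanishes on its boundary. The resulting
    closed form B vanishes on the boundary. With h (t, y) = t y, the six-form
    h^*B /\ B /\ B on [0,1] x [0,1]^6 is closed; it vanishes for t = 0 and on the
    lateral faces, and restricts to a multiple of the Pfaffian of B for t = 1. By
    Stokes the Pfaffian of B has mean zero over the cube, whereas it has a constant
    sign inside, where B is nondegenerate ([no_nondegenerate_closed_form]). Stokes is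
    used in the form of an estimate on Riemann sums ([grid_divergence]), so that no
    integral is formed.

    The remaining ingredient is the identification of the Levi-Civita connection with
    the tangential part of the ambient derivative ([nablaE]), whence the covariant
    derivative of J is P (dJ) P ([nabla_endE]). The second inequality follows from the
    first by scaling X. *)

(** * Calculus of smooth maps *)

Section DifferentiableExtra.
Context {R : realType} {V : normedModType R}.

Lemma near_eq_differentiable (W : normedModType R) (f g : V -> W) (x : V) :
  (\near x, f x = g x) -> differentiable f x -> differentiable g x.
Proof.
move=> fg df; have fgx := nbhs_singleton fg.
suff e : g \o shift x = cst (g x) + 'd f x +o_ 0 id.
  apply/diff_locallyP; have dc := diff_continuous df.
  by rewrite (diff_unique dc e); split.
apply/eqaddoP => eps eps0.
have /eqaddoP/(_ eps eps0) H := diff_locally df.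
move: fg; rewrite (near_shift 0 x) /= subr0 => fg.
by apply: filterS2 H fg => h; rewrite /= !fctE /= fgx => + E; rewrite E.
Qed.
End DifferentiableExtra.

Section Entries.
Context {R : realType} {V : normedModType R}.

(** Together with its analogues below, this reduces the calculus of matrix-valued maps
    to that of scalar ones. *)
Lemma differentiable_mxP (m n : nat) (F : V -> 'M[R]_(m, n)) (x : V) :
  differentiable F x <-> forall i j, differentiable (fun y => F y i j) x.
Proof.
split=> [dF i j|dF].
  exact: (@differentiable_comp _ _ _ _ F (fun N : 'M[R]_(m, n) => N i j : R) x
    dF (differentiable_coord _ _ _)).
have -> : F = \sum_(k < m) \sum_(l < n)
    (fun y => F y k l *: delta_mx k l : 'M[R]_(m, n)).
  apply/funext => y; rewrite [LHS]matrix_sum_delta fct_sumE.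
  by apply: eq_bigr => k _; rewrite fct_sumE.
apply: differentiable_sum => k; apply: differentiable_sum => l.
exact: differentiableZl.
Qed.

Lemma derive_entry (m n : nat) (F : V -> 'M[R]_(m, n)) (x v : V) i j :
  differentiable F x -> ('D_v F x) i j = 'D_v (fun y => F y i j) x.
Proof. by move=> dF; rewrite derive_mx ?mxE //; exact: diff_derivable. Qed.

Lemma derive_comp_row (n : nat) (p : V -> 'rV[R]_n) (W : normedModType R)
    (g : 'rV[R]_n -> W) (x v : V) :
  differentiable p x -> differentiable g (p x) ->
  'D_v (g \o p) x = 'D_('D_v p x) g (p x).
Proof.
move=> dp dg; rewrite !deriveE //; last exact: differentiable_comp.
by rewrite diff_comp.
Qed.

Lemma derive_row_sum (n : nat) (W : normedModType R) (g : 'rV[R]_n -> W)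
    (x v : 'rV[R]_n) : differentiable g x ->
  'D_v g x = \sum_(i < n) v ord0 i *: 'D_(delta_mx ord0 i) g x.
Proof.
move=> dg; rewrite deriveE // {1}[v]row_sum_delta linear_sum.
by apply: eq_bigr => i _; rewrite linearZ deriveE.
Qed.

End Entries.

Section IteratedDerivatives.
Context {R : realType} {V : normedModType R}.

(** [n + 1] successive directional derivatives. Unlike in [smooth_on], the recursion
    peels the derivative that is taken first, which is what the Leibniz and chain
    rules produce; [smooth_on] is the conjunction of all these conditions. *)
Fixpoint Ck (n : nat) (W : normedModType R) (U : set V) (f : V -> W) : Prop :=
  (forall x, U x -> differentiable f x) /\
  if n is m.+1 then forall v, Ck m U ('D_v f) else True.

Lemma smooth_on_Ck (W : normedModType R) (U : set V) (f : V -> W) :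
  smooth_on U f <-> forall n, Ck n U f.
Proof.
split=> [sf n|cf vs].
  elim: n f sf => [|n IH] f sf; split=> //; try exact: (sf [::]).
  move=> v; apply: IH => vs x Ux; have := sf (rcons vs v) x Ux.
  by rewrite foldr_rcons.
elim/last_ind: vs f cf => [|vs v IH] f cf x Ux; first by have [+ _] := cf 0%N; apply.
rewrite foldr_rcons; apply: IH => // n; by have [_ +] := cf n.+1; apply.
Qed.

Lemma Ck_diff (W : normedModType R) n (U : set V) (f : V -> W) x :
  Ck n U f -> U x -> differentiable f x.
Proof. by case: n => [|n] [+ _]; apply. Qed.

Lemma CkW (W : normedModType R) n (U : set V) (f : V -> W) :
  Ck n.+1 U f -> Ck n U f.
Proof.
elim: n f => [|n IH] f [df cf]; split=> // v; exact/IH/cf.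
Qed.

Section Open.
Context (U : set V) (oU : open U).

Lemma Ck_ext (W : normedModType R) n (f g : V -> W) :
  (forall x, U x -> f x = g x) -> Ck n U f -> Ck n U g.
Proof.
have nearU x : U x -> \near x, U x by move=> Ux; exact: open_nbhs_nbhs.
elim: n f g => [|n IH] f g fg [df cf]; split=> //; try move=> x Ux.
- apply: near_eq_differentiable (df x Ux).
  by apply: filterS (nearU x Ux); exact: fg.
- apply: near_eq_differentiable (df x Ux).
  by apply: filterS (nearU x Ux); exact: fg.
move=> v; apply: IH (cf v) => x Ux; apply: near_eq_derive.
by apply: filterS (nearU x Ux); exact: fg.
Qed.

Lemma Ck_cst (W : normedModType R) n (c : W) : Ck n U (fun=> c).
Proof.
elim: n c => [|n IH] c; split=> //; try by move=> x _; exact: differentiable_cst.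
move=> v; apply: Ck_ext (IH 0) => x _; by rewrite derive_cst.
Qed.

Lemma CkD (W : normedModType R) n (f g : V -> W) :
  Ck n U f -> Ck n U g -> Ck n U (fun x => f x + g x).
Proof.
elim: n f g => [|n IH] f g [df cf] [dg cg]; split=> //;
  try by move=> x Ux; apply: differentiableD; [exact: df|exact: dg].
move=> v; apply: Ck_ext (IH _ _ (cf v) (cg v)) => x Ux.
by rewrite -deriveD //; apply: diff_derivable; [exact: df|exact: dg].
Qed.

(** By induction on the order: the derivative of a product is a sum of products whose
    factors have one derivative less to spare. [CkV] and [Ck_comp] go the same way. *)
Lemma CkM n (f g : V -> R) :
  Ck n U f -> Ck n U g -> Ck n U (fun x => f x * g x).
Proof.
elim: n f g => [|n IH] f g cf cg; split=> //;
  try by move=> x Ux; apply: differentiableM; [exact: Ck_diff cf Ux|exact: Ck_diff cg Ux].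
move=> v; have [_ cf'] := cf; have [_ cg'] := cg.
apply: Ck_ext (CkD (IH _ _ (CkW cf) (cg' v)) (IH _ _ (CkW cg) (cf' v))) => x Ux.
by rewrite -[RHS]/('D_v (f * g) x) deriveM //;
  apply: diff_derivable; [exact: Ck_diff cf Ux|exact: Ck_diff cg Ux].
Qed.

Lemma CkV n (f : V -> R) :
  (forall x, U x -> f x != 0) -> Ck n U f -> Ck n U (fun x => (f x)^-1).
Proof.
move=> f0; elim: n => [|n IH] cf; split=> //;
  try by move=> x Ux; apply: differentiableV; [exact: Ck_diff cf Ux|exact: f0].
move=> v; have [_ cf'] := cf; have ci := IH (CkW cf).
have H := CkM (CkM (Ck_cst n (-1 : R)) (CkM ci ci)) (cf' v).
apply: Ck_ext H => x Ux.
rewrite deriveV ?f0 //; last by apply: diff_derivable; exact: Ck_diff cf Ux.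
by rewrite /GRing.scale /= expr2 invfM mulN1r.
Qed.

Lemma Ck_mxP n (a b : nat) (F : V -> 'M[R]_(a, b)) :
  Ck n U F <-> forall i j, Ck n U (fun x => F x i j).
Proof.
elim: n F => [|n IH] F; split.
- by move=> [dF _] i j; split=> // x Ux; apply: (differentiable_mxP _ _).1 => //; exact: dF.
- by move=> cF; split=> // x Ux; apply/differentiable_mxP => i j; exact: Ck_diff (cF i j) Ux.
- move=> [dF cF] i j; split=> [x Ux|v].
    by apply: (differentiable_mxP _ _).1 => //; exact: dF.
  apply: Ck_ext ((IH _).1 (cF v) i j) => x Ux.
  by rewrite derive_entry //; exact: dF.
- move=> cF; have dF x : U x -> differentiable F x.
    by move=> Ux; apply/differentiable_mxP => i j; exact: Ck_diff (cF i j) Ux.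
  split=> // v; apply/IH => i j; have [_ +] := cF i j => /(_ v).
  by apply: Ck_ext => x Ux; rewrite derive_entry //; exact: dF.
Qed.

Lemma Ck_sum (W : normedModType R) n (I : Type) (r : seq I) (P : pred I) (f : I -> V -> W) :
  (forall i, Ck n U (f i)) -> Ck n U (fun x => \sum_(i <- r | P i) f i x).
Proof.
move=> cf; elim: r => [|i r IH].
  by apply: Ck_ext (Ck_cst n 0) => x _; rewrite big_nil.
apply: Ck_ext (_ : Ck n U (fun x => (if P i then f i x else 0) + \sum_(i <- r | P i) f i x)) => [x _|].
  by rewrite big_cons; case: ifP; rewrite ?add0r.
by apply: CkD => //; case: (P i) => //; exact: Ck_cst.
Qed.

End Open.

End IteratedDerivatives.

Lemma Ck_comp (R : realType) (V : normedModType R) n k (U : set V)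
    (U' : set 'rV[R]_k) (p : V -> 'rV[R]_k) (g : 'rV[R]_k -> R) :
  open U -> (forall x, U x -> U' (p x)) ->
  Ck n U p -> Ck n U' g -> Ck n U (fun x => g (p x)).
Proof.
move=> oU pU; elim: n g => [|n IH] g cp cg; split=> //;
  try by move=> x Ux; apply: (@differentiable_comp _ _ _ _ p g);
    [exact: Ck_diff cp Ux|exact: Ck_diff cg (pU _ Ux)].
move=> v; have [_ cp'] := cp; have [_ cg'] := cg.
have cs : Ck n U (fun x => \sum_(i < k)
    ('D_v p x) ord0 i * 'D_(delta_mx ord0 i) g (p x)).
  apply: (Ck_sum oU) => i; apply: (CkM oU).
    exact: ((Ck_mxP oU _ _).1 (cp' v)).
  exact: IH (CkW cp) (cg' _).
apply: (Ck_ext oU) cs => x Ux.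
rewrite -[RHS]/('D_v (g \o p) x) derive_comp_row ?derive_row_sum //.
- exact: Ck_diff cg (pU _ Ux).
- exact: Ck_diff cp Ux.
- exact: Ck_diff cg (pU _ Ux).
Qed.

Section SmoothOn.
Context {R : realType} {V : normedModType R} (U : set V) (oU : open U).

Lemma smooth_on_diff (W : normedModType R) (f : V -> W) x :
  smooth_on U f -> U x -> differentiable f x.
Proof. by move=> sf; exact: (sf [::]). Qed.

Lemma smooth_on_derive (W : normedModType R) (f : V -> W) v :
  smooth_on U f -> smooth_on U ('D_v f).
Proof. by move=> /smooth_on_Ck sf; apply/smooth_on_Ck => n; have [_ +] := sf n.+1; apply. Qed.

Lemma smooth_on_ext (W : normedModType R) (f g : V -> W) :
  (forall x, U x -> f x = g x) -> smooth_on U f -> smooth_on U g.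
Proof.
by move=> fg /smooth_on_Ck sf; apply/smooth_on_Ck => n; exact: Ck_ext (sf n).
Qed.

Lemma smooth_on_cst (W : normedModType R) (c : W) : smooth_on U (fun=> c).
Proof. by apply/smooth_on_Ck => n; exact: Ck_cst. Qed.

Lemma smooth_onD (W : normedModType R) (f g : V -> W) :
  smooth_on U f -> smooth_on U g -> smooth_on U (fun x => f x + g x).
Proof.
by move=> /smooth_on_Ck sf /smooth_on_Ck sg; apply/smooth_on_Ck => n; exact: CkD.
Qed.

Lemma smooth_onM (f g : V -> R) :
  smooth_on U f -> smooth_on U g -> smooth_on U (fun x => f x * g x).
Proof.
by move=> /smooth_on_Ck sf /smooth_on_Ck sg; apply/smooth_on_Ck => n; exact: CkM.
Qed.

Lemma smooth_onN (f : V -> R) : smooth_on U f -> smooth_on U (fun x => - f x).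
Proof.
move=> sf; apply: smooth_on_ext (smooth_onM (smooth_on_cst (-1 : R)) sf) => x _.
by rewrite mulN1r.
Qed.

Lemma smooth_onV (f : V -> R) : (forall x, U x -> f x != 0) ->
  smooth_on U f -> smooth_on U (fun x => (f x)^-1).
Proof.
by move=> f0 /smooth_on_Ck sf; apply/smooth_on_Ck => n; exact: CkV.
Qed.

Lemma smooth_on_sum (W : normedModType R) (I : Type) (r : seq I) (P : pred I)
    (f : I -> V -> W) :
  (forall i, smooth_on U (f i)) -> smooth_on U (fun x => \sum_(i <- r | P i) f i x).
Proof.
move=> sf; apply/smooth_on_Ck => n; apply: Ck_sum => // i.
by move/smooth_on_Ck: (sf i).
Qed.

Lemma smooth_on_prod (I : Type) (r : seq I) (P : pred I) (f : I -> V -> R) :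
  (forall i, smooth_on U (f i)) -> smooth_on U (fun x => \prod_(i <- r | P i) f i x).
Proof.
move=> sf; elim: r => [|i r IH].
  by apply: smooth_on_ext (smooth_on_cst (1 : R)) => x _; rewrite big_nil.
apply: smooth_on_ext (_ : smooth_on U
  (fun x => (if P i then f i x else 1) * \prod_(i <- r | P i) f i x)) => [x _|].
  by rewrite big_cons; case: ifP; rewrite ?mul1r.
by apply: smooth_onM => //; case: (P i) => //; exact: smooth_on_cst.
Qed.

Lemma smooth_on_mxP (a b : nat) (F : V -> 'M[R]_(a, b)) :
  smooth_on U F <-> forall i j, smooth_on U (fun x => F x i j).
Proof.
split=> [/smooth_on_Ck sF i j|sF]; apply/smooth_on_Ck => n.
  exact: (Ck_mxP oU _ _).1 (sF n) i j.
by apply/(Ck_mxP oU) => i j; move/smooth_on_Ck: (sF i j).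
Qed.

Lemma smooth_on_comp (k : nat) (U' : set 'rV[R]_k) (p : V -> 'rV[R]_k)
    (g : 'rV[R]_k -> R) : (forall x, U x -> U' (p x)) ->
  smooth_on U p -> smooth_on U' g -> smooth_on U (fun x => g (p x)).
Proof.
move=> pU /smooth_on_Ck sp /smooth_on_Ck sg; apply/smooth_on_Ck => n.
exact: Ck_comp pU (sp n) (sg n).
Qed.

Lemma smooth_on_mulmx (a b c : nat) (F : V -> 'M[R]_(a, b)) (G : V -> 'M[R]_(b, c)) :
  smooth_on U F -> smooth_on U G -> smooth_on U (fun x => F x *m G x).
Proof.
move=> /smooth_on_mxP sF /smooth_on_mxP sG; apply/smooth_on_mxP => i j.
apply: (@smooth_on_ext _ (fun x => \sum_k F x i k * G x k j)) => [x _|].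
  by rewrite mxE.
by apply: smooth_on_sum => k; exact: smooth_onM.
Qed.

Lemma smooth_on_trmx (a b : nat) (F : V -> 'M[R]_(a, b)) :
  smooth_on U F -> smooth_on U (fun x => (F x)^T).
Proof.
move=> /smooth_on_mxP sF; apply/smooth_on_mxP => i j.
by apply: smooth_on_ext (sF j i) => x _; rewrite mxE.
Qed.

Lemma smooth_on_mxtrace (a : nat) (F : V -> 'M[R]_a) :
  smooth_on U F -> smooth_on U (fun x => \tr (F x)).
Proof. by move=> /smooth_on_mxP sF; apply: smooth_on_sum => i; exact: sF. Qed.

Lemma smooth_on_scale (a b : nat) (f : V -> R) (F : V -> 'M[R]_(a, b)) :
  smooth_on U f -> smooth_on U F -> smooth_on U (fun x => f x *: F x).
Proof.
move=> sf /smooth_on_mxP sF; apply/smooth_on_mxP => i j.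
apply: (@smooth_on_ext _ (fun x => f x * F x i j)) => [x _|]; first by rewrite mxE.
exact: smooth_onM.
Qed.

End SmoothOn.

Lemma smooth_diff (R : realType) (V W : normedModType R) (f : V -> W) x :
  smooth_on setT f -> differentiable f x.
Proof. by move=> sf; exact: smooth_on_diff sf I. Qed.

Lemma smooth_onS (R : realType) (V W : normedModType R) (U U' : set V) (f : V -> W) :
  U `<=` U' -> smooth_on U' f -> smooth_on U f.
Proof. by move=> UU sf vs x /UU; exact: sf. Qed.

Lemma derive_coord (R : realType) (a b : nat) (x v : 'M[R]_(a, b)) i j :
  'D_v (fun y : 'M[R]_(a, b) => y i j) x = v i j.
Proof.
by rewrite -(derive_entry (F := id)) ?derive_id //; exact: ex_diff.
Qed.

Lemma smooth_on_id (R : realType) (a b : nat) (U : set 'M[R]_(a, b)) :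
  open U -> smooth_on U (fun y : 'M[R]_(a, b) => y).
Proof.
move=> oU; apply/smooth_on_Ck => n; case: n => [|n]; split=> //;
  try by move=> x _; exact: ex_diff.
move=> v; apply: (Ck_ext oU) (Ck_cst oU n v) => x _; by rewrite derive_id.
Qed.

(** * The divergence theorem on a grid *)

Definition cube (R : realType) (n : nat) : set 'rV[R]_n :=
  [set z | forall i, 0 <= z ord0 i <= 1].

Definition unit_vec (R : realType) (n : nat) (k : 'I_n) : 'rV[R]_n := delta_mx ord0 k.

Section LineMVT.
Context {R : realType} {V : normedModType R}.

Lemma is_derive_line (f : V -> R) (z e : V) (s : R) :
  differentiable f (z + s *: e) ->
  is_derive s 1 (fun s => f (z + s *: e)) ('D_e f (z + s *: e)).
Proof.
move=> df; have dl : is_diff s (fun s : R => z + s *: e) (fun h => h *: e).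
  have H := is_diffD (is_diff_cst z s) (is_diff_scalel s e).
  by apply: is_diff_eq H _; apply/funext => h; rewrite !fctE add0r.
pose l (s : R) := z + s *: e.
have dc : differentiable (f \o l) s by apply: differentiable_comp.
rewrite -/(f \o l); apply: DeriveDef; first exact: diff_derivable.
by rewrite deriveE // diff_comp //= diff_val scale1r deriveE.
Qed.

Lemma line_MVT (f : V -> R) (z e : V) (h : R) : 0 <= h ->
  (forall x, differentiable f x) ->
  exists2 c, 0 <= c <= h & f (z + h *: e) - f z = h * 'D_e f (z + c *: e).
Proof.
move=> h0 df.
have [|c] := @MVT_segment R (fun s => f (z + s *: e)) (fun s => 'D_e f (z + s *: e)) 0 h h0
  (fun s _ => is_derive_line (df _)).
  apply: derivable_within_continuous => s _.
  by have [] := is_derive_line (df (z + s *: e)).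
rewrite in_itv /= => ch; rewrite scale0r addr0 subr0 => ->.
by exists c => //; rewrite mulrC.
Qed.

End LineMVT.

Lemma cube_compact (R : realType) (n : nat) : compact (@cube R n).
Proof.
have -> : @cube R n = [set z | forall i, (`[0, 1]%classic : set R) (z ord0 i)].
  by apply/seteqP; split => z /= Hz i; have := Hz i; rewrite in_itv.
apply: (@rV_compact R n (fun=> `[0, 1]%classic)) => i; exact: segment_compact.
Qed.

Lemma bounded_on_cube (R : realType) (n : nat) (f : 'rV[R]_n -> R) :
  continuous f -> exists2 C, 0 <= C & forall z, cube z -> `|f z| <= C.
Proof.
move=> cf; have c0 : @cube R n !=set0.
  by exists 0 => i; rewrite mxE lexx ler01.
have [|c _ Hc] := @EVT_max_rV R n (fun z => `|f z|) _ c0 (@cube_compact R n).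
  apply: continuous_subspaceT => z.
  exact: cvg_norm (cf z).
by exists `|f c| => // z cz; apply: Hc; rewrite inE.
Qed.

Section Grid.
Context {R : realType} (n M : nat).
Local Notation h := (M.+1%:R^-1 : R).
Implicit Types q : {ffun 'I_n -> 'I_M.+1}.

Definition grid_pt q : 'rV[R]_n := \row_i ((q i)%:R * h).
Definition set_coord (z : 'rV[R]_n) (k : 'I_n) (a : R) : 'rV[R]_n :=
  \row_i (if i == k then a else z ord0 i).
Definition grid_shift (k : 'I_n) q : {ffun 'I_n -> 'I_M.+1} :=
  [ffun i => if i == k then ordS (q i) else q i].

Lemma grid_shift_inj k : injective (grid_shift k).
Proof.
move=> q r /ffunP e; apply/ffunP => i; have := e i; rewrite !ffunE.
by case: ifP => // _; exact: ordS_inj.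
Qed.

Lemma grid_pt_shift k q : grid_pt q + h *: unit_vec R k =
  if q k == ord_max then set_coord (grid_pt q) k 1 else grid_pt (grid_shift k q).
Proof.
have M0 : (M.+1%:R : R) != 0 by rewrite pnatr_eq0.
apply/rowP => i; rewrite /unit_vec !mxE eqxx /=.
have [->|ik] := eqVneq i k; last by case: ifP; rewrite !mxE ?ffunE (negPf ik) mulr0 addr0.
rewrite mulr1 -{2}[h]mul1r -mulrDl natr1; case: ifP => [/eqP ->|qm].
  by rewrite !mxE eqxx /= divff.
rewrite !mxE ffunE eqxx /= modn_small // ltn_neqAle ltn_ord andbT.
by rewrite eqSS; apply: contraFN qm => qM; apply/eqP/val_inj/eqP.
Qed.

Lemma grid_pt_wrap k q : q k == ord_max ->
  grid_pt (grid_shift k q) = set_coord (grid_pt q) k 0.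
Proof.
move=> /eqP qk; apply/rowP => i; rewrite !mxE ffunE.
by have [->|//] := eqVneq i k; rewrite qk /= modnn mul0r.
Qed.

(** Summation by parts: the cyclic shift in direction [k] permutes the grid, and moving
    by one step agrees with it except on the last layer, where a step reaches the face
    of coordinate 1 and the shift returns to the face of coordinate 0. *)
Lemma grid_telescope k (f : 'rV[R]_n -> R) :
  \sum_(q : {ffun 'I_n -> 'I_M.+1})
     (f (grid_pt q + h *: unit_vec R k) - f (grid_pt q)) =
  \sum_(q : {ffun 'I_n -> 'I_M.+1} | q k == ord_max)
     (f (set_coord (grid_pt q) k 1) - f (set_coord (grid_pt q) k 0)).
Proof.
rewrite big_split /= sumrN.
have -> : \sum_(q : {ffun 'I_n -> 'I_M.+1}) f (grid_pt q) =
    \sum_(q : {ffun 'I_n -> 'I_M.+1}) f (grid_pt (grid_shift k q)).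
  by rewrite (reindex_inj (@grid_shift_inj k)).
rewrite -sumrN -big_split /= [RHS]big_mkcond; apply: eq_bigr => q _.
rewrite grid_pt_shift; case: ifP => [qm|_]; last by rewrite subrr.
by rewrite grid_pt_wrap.
Qed.

Lemma grid_pt_cube q : cube (grid_pt q).
Proof.
move=> i; rewrite mxE divr_ge0 ?ler0n //= ler_pdivrMr ?ltr0Sn // mul1r ler_nat.
exact: ltnW.
Qed.

Lemma grid_segment_cube q k c : 0 <= c <= h -> cube (grid_pt q + c *: unit_vec R k).
Proof.
move=> /andP[c0 ch] i; rewrite /unit_vec !mxE eqxx /=.
have := grid_pt_cube q i; rewrite mxE => /andP[q0 q1].
have [ik|ik] := eqVneq i k; last by rewrite mulr0 addr0 q0.
rewrite mulr1 addr_ge0 //=.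
apply: (@le_trans _ _ ((q i)%:R * h + h)); first by rewrite lerD2l.
rewrite -{2}[h]mul1r -mulrDl natr1 ler_pdivrMr ?ltr0Sn // mul1r ler_nat.
exact: ltn_ord.
Qed.
End Grid.

(** A discrete divergence theorem: the flux of a divergence-free field through the
    boundary of the unit cube, sampled on a grid of mesh [1 / (M + 1)], is negligible
    against the number [(M + 1) ^ (n - 1)] of sample points on a face. Each increment
    in direction [k] equals the mesh times the partial derivative up to the square of
    the mesh times a bound for the second derivative. *)
Lemma grid_divergence (R : realType) (n : nat) (V : 'I_n -> 'rV[R]_n -> R) :
  (forall k, smooth_on setT (V k)) ->
  (forall z, \sum_k 'D_(unit_vec R k) (V k) z = 0) ->
  exists2 C : R, 0 <= C & forall M,
    `| \sum_k \sum_(q : {ffun 'I_n -> 'I_M.+1} | q k == ord_max)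
      (V k (set_coord (grid_pt q) k 1) - V k (set_coord (grid_pt q) k 0)) |
    <= C * M.+1%:R ^+ n / M.+1%:R ^+ 2.
Proof.
move=> sV divV.
have bnd k : exists2 C, 0 <= C & forall z, cube z ->
    `|'D_(unit_vec R k) ('D_(unit_vec R k) (V k)) z| <= C.
  apply: bounded_on_cube => z; apply: differentiable_continuous.
  exact: (sV k [:: _; _]).
have [C C0 HC] : exists2 C : 'I_n -> R, (forall k, 0 <= C k) &
    forall k z, cube z -> `|'D_(unit_vec R k) ('D_(unit_vec R k) (V k)) z| <= C k.
  exists (fun k => sval (cid2 (bnd k))) => k; by case: (cid2 _).
exists (\sum_k C k); first by apply: sumr_ge0.
move=> M; set h : R := M.+1%:R^-1.
have h0 : 0 <= h by rewrite invr_ge0.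
(* Two applications of the mean value theorem, to the field and to its
   derivative. *)
have taylor k (q : {ffun 'I_n -> 'I_M.+1}) :
  `|V k (grid_pt q + h *: unit_vec R k) - V k (grid_pt q)
     - h * 'D_(unit_vec R k) (V k) (grid_pt q)| <= C k * h ^+ 2.
  have [c c0h ->] := line_MVT (grid_pt q) (unit_vec R k) h0 (fun x => sV k [::] x I).
  rewrite -mulrBr normrM (ger0_norm h0) expr2 mulrCA ler_wpM2l //.
  have /andP[c0 ch] := c0h.
  have [d /andP[d0 dc] ->] := line_MVT (grid_pt q) (unit_vec R k) c0
    (fun x => sV k [:: unit_vec R k] x I).
  rewrite normrM (ger0_norm c0) mulrC; apply: ler_pM => //.
  by apply/HC/grid_segment_cube; rewrite d0 (le_trans dc).
under eq_bigr do rewrite -grid_telescope.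
rewrite exchange_big /= -/h.
have -> : \sum_(q : {ffun 'I_n -> 'I_M.+1}) \sum_k
    (V k (grid_pt q + h *: unit_vec R k) - V k (grid_pt q)) =
  \sum_(q : {ffun 'I_n -> 'I_M.+1}) \sum_k
    (V k (grid_pt q + h *: unit_vec R k) - V k (grid_pt q)
     - h * 'D_(unit_vec R k) (V k) (grid_pt q)).
  apply: eq_bigr => q _; rewrite [RHS]big_split /= sumrN -mulr_sumr divV.
  by rewrite mulr0 subr0.
apply: (le_trans (ler_norm_sum _ _ _)).
apply: (@le_trans _ _ (\sum_(q : {ffun 'I_n -> 'I_M.+1}) (\sum_k C k) * h ^+ 2)).
  apply: ler_sum => q _; apply: (le_trans (ler_norm_sum _ _ _)).
  by rewrite mulr_suml; apply: ler_sum => k _.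
rewrite sumr_const -[X in _ *+ X]/(#|{: {ffun 'I_n -> 'I_M.+1}}|) card_ffun.
rewrite !card_ord -[leLHS]mulr_natr natrX exprVn.
by rewrite -!mulrA [X in _ * X]mulrC.
Qed.

(** * The Pfaffian of a skew form in dimension six *)

Section Pfaffian.
Context {R : comRingType}.
Implicit Types (B D : nat -> nat -> R).

Definition others (i j : nat) : seq nat :=
  [seq k <- iota 0 6 | (k != i) && (k != j)].

(** The Pfaffian of the 4x4 block with rows [k], [l], [m], [n]. *)
Definition pf4 B k l m n : R := B k l * B m n - B k m * B l n + B k n * B l m.

Definition pf4_polar B D k l m n : R :=
  D k l * B m n + B k l * D m n - (D k m * B l n + B k m * D l n)
  + (D k n * B l m + B k n * D l m).

Definition psign (i j : nat) : R :=
  if (i < j)%N then (-1) ^+ (i + j).+1 else if (j < i)%N then (-1) ^+ (i + j) else 0.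

(** The Pfaffian adjugate. Up to sign, its entry [(i, j)] is the Pfaffian of the block
    that avoids [i] and [j]; these are the coefficients of half the square of the
    two-form [B], read through the volume form. Forms are indexed by [nat] so that
    the entries of concrete index compute. *)
Definition padj B (i j : nat) : R :=
  let o := others i j in
  psign i j * pf4 B (nth 0 o 0) (nth 0 o 1) (nth 0 o 2) (nth 0 o 3).

(** The derivative of [padj] at [B] in the direction [D]. *)
Definition padj_polar B D (i j : nat) : R :=
  let o := others i j in
  psign i j * pf4_polar B D (nth 0 o 0) (nth 0 o 1) (nth 0 o 2) (nth 0 o 3).

Definition pfaffian6 B : R := \sum_(j < 6) B 0 j * padj B 0 j.

Lemma psign_skew i j : psign j i = - psign i j.
Proof.
rewrite /psign; case: (ltngtP i j) => _; rewrite ?oppr0 // addnC exprS mulN1r ?opprK //.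
Qed.

Lemma others_sym i j : others j i = others i j.
Proof. by apply: eq_filter => k; rewrite andbC. Qed.

Lemma padj_skew B i j : padj B j i = - padj B i j.
Proof. by rewrite /padj psign_skew others_sym mulNr. Qed.

Section Skew.
Context (B : nat -> nat -> R).
Context (skew : forall i j, B i j = - B j i) (diag : forall i, B i i = 0).

(** Expansion of the Pfaffian along row [k] when [i = k]; for [i <> k], the same
    expansion for the form in which row [k] has been replaced by row [i], whose
    Pfaffian vanishes. *)
Lemma mul_padj i k : (i < 6)%N -> (k < 6)%N ->
  \sum_(j < 6) B i j * padj B k j = pfaffian6 B *+ (i == k).
Proof.
have s10 := skew 1 0; have s20 := skew 2 0; have s30 := skew 3 0.
have s40 := skew 4 0; have s50 := skew 5 0; have s21 := skew 2 1.
have s31 := skew 3 1; have s41 := skew 4 1; have s51 := skew 5 1.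
have s32 := skew 3 2; have s42 := skew 4 2; have s52 := skew 5 2.
have s43 := skew 4 3; have s53 := skew 5 3; have s54 := skew 5 4.
have sE := (s10, s20, s30, s40, s50, s21, s31, s41, s51, s32, s42, s52, s43, s53, s54).
rewrite /pfaffian6 !big_ord_recl !big_ord0 /=.
rewrite /bump /=; do 6 (case: i => [|i]; first (
  do 6 (case: k => [|k]; first by
    move=> _ _; rewrite /padj /psign /pf4 /= ?diag ?sE; ring); by [])); by [].
Qed.

(** The square of a closed two-form is closed: the rows of its Pfaffian adjugate are
    divergence free. *)
Lemma padj_polar_div (D : nat -> nat -> nat -> R) :
  (forall k i j, D k i j = - D k j i) ->
  (forall i j k, D i j k + D j k i + D k i j = 0) ->
  forall j, (j < 6)%N -> \sum_(k < 6) padj_polar B (D k) j k = 0.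
Proof.
move=> Dskew Dclosed.
have cl i j k : D k i j = D j i k - D i j k.
  by apply/eqP; rewrite -subr_eq0 (Dskew j i k) opprD !opprK -(Dclosed i j k); apply/eqP; ring.
have sE := (cl 0 1 2, cl 0 1 3, cl 0 1 4, cl 0 1 5, cl 0 2 3, cl 0 2 4, cl 0 2 5,
  cl 0 3 4, cl 0 3 5, cl 0 4 5, cl 1 2 3, cl 1 2 4, cl 1 2 5, cl 1 3 4,
  cl 1 3 5, cl 1 4 5, cl 2 3 4, cl 2 3 5, cl 2 4 5, cl 3 4 5)%N.
move=> j; rewrite !big_ord_recl !big_ord0 /bump /=.
do 6 (case: j => [|j]; first by
  move=> _; rewrite /padj_polar /psign /pf4_polar /= ?sE; ring); by [].
Qed.

End Skew.
End Pfaffian.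

(** If the Pfaffian vanishes, the columns of the adjugate lie in the kernel, so that the
    adjugate is zero: the square of the form vanishes, the form has rank at most two,
    and its contractions with the vectors of [v] below are zero. *)
Lemma pfaffian6_neq0 (F : fieldType) (B : nat -> nat -> F) :
  (forall i j, B i j = - B j i) -> (forall i, B i i = 0) ->
  (forall v : nat -> F, (forall j, (j < 6)%N -> \sum_(i < 6) v i * B i j = 0) ->
    forall i, (i < 6)%N -> v i = 0) ->
  pfaffian6 B != 0.
Proof.
move=> skew diag nondeg; apply/eqP => pf0.
have adj0 k j : (k < 6)%N -> (j < 6)%N -> padj B k j = 0.
  move=> k6; apply: nondeg => {}j j6.
  transitivity (- \sum_(i < 6) B j i * padj B k i).
    by rewrite -sumrN; apply: eq_bigr => i _; rewrite (skew i) mulrN mulrC.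
  by rewrite mul_padj // pf0 mul0rn oppr0.
have p4 i j : (i < j < 6)%N -> let o := others i j in
    pf4 B (nth 0 o 0) (nth 0 o 1) (nth 0 o 2) (nth 0 o 3) = 0.
  move=> /andP[ij j6]; have := adj0 i j (ltn_trans ij j6) j6.
  rewrite /padj /psign ij => /eqP; rewrite mulf_eq0 expf_eq0 oppr_eq0 oner_eq0 andbF /=.
  by move/eqP.
have q01 := p4 4 5 isT; have q02 := p4 3 5 isT; have q03 := p4 3 4 isT.
have q04 := p4 2 5 isT; have q05 := p4 1 5 isT; have q06 := p4 1 2 isT.
have q07 := p4 2 3 isT; have q08 := p4 2 4 isT; have q09 := p4 1 3 isT.
have q10 := p4 1 4 isT.
rewrite /pf4 /= in q01 q02 q03 q04 q05 q06 q07 q08 q09 q10.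
have s10 := skew 1 0; have s20 := skew 2 0; have s30 := skew 3 0.
have s40 := skew 4 0; have s50 := skew 5 0; have s21 := skew 2 1.
have s31 := skew 3 1; have s41 := skew 4 1; have s51 := skew 5 1.
have s32 := skew 3 2; have s42 := skew 4 2; have s52 := skew 5 2.
have s43 := skew 4 3; have s53 := skew 5 3; have s54 := skew 5 4.
have sE := (s10, s20, s30, s40, s50, s21, s31, s41, s51, s32, s42, s52, s43, s53, s54).
(* The pairing of this vector with the basis vector of index j is the Pfaffian of the
   block 0, a, b, j. *)
pose v a b (i : nat) := if i == 0%N then B a b else if i == a then - B 0 b
  else if i == b then B 0 a else 0.
have opp0 (x : F) : x = 0 -> - x = 0 by move=> ->; rewrite oppr0.
have row012 j : (j < 6)%N -> \sum_(i < 6) v 1 2 i * B i j = 0.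
  rewrite !big_ord_recl big_ord0 /bump /v /=.
  do 6 (case: j => [|j]; first by move=> _; rewrite ?diag ?sE;
    first [ring | rewrite -[RHS]q01; ring | rewrite -[RHS]q02; ring | rewrite -[RHS]q03; ring]).
  by [].
have row034 j : (j < 6)%N -> \sum_(i < 6) v 3 4 i * B i j = 0.
  rewrite !big_ord_recl big_ord0 /bump /v /=.
  do 6 (case: j => [|j]; first by move=> _; rewrite ?diag ?sE;
    first [ring | rewrite -[RHS]q04; ring | rewrite -[RHS]q05; ring | rewrite -[RHS]q06; ring]).
  by [].
have row015 j : (j < 6)%N -> \sum_(i < 6) v 1 5 i * B i j = 0.
  rewrite !big_ord_recl big_ord0 /bump /v /=.
  do 6 (case: j => [|j]; first by move=> _; rewrite ?diag ?sE;
    first [ring | rewrite -[RHS](opp0 _ q07); ring | rewrite -[RHS](opp0 _ q08); ring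
      | rewrite -[RHS](opp0 _ q03); ring]).
  by [].
have b1 := nondeg _ row012 2 isT; have b2 := nondeg _ row012 1 isT.
have b3 := nondeg _ row034 4 isT; have b4 := nondeg _ row034 3 isT.
have b5 := nondeg _ row015 1 isT.
rewrite /v /= in b1 b2 b3 b4 b5.
have e0 j : (j < 6)%N -> \sum_(i < 6) (if i == 0%N :> nat then 1 else 0) * B i j = 0.
  rewrite !big_ord_recl big_ord0 /bump /=.
  do 6 (case: j => [|j]; first by
    move=> _; rewrite !mul0r !addr0 mul1r ?diag //;
    first [done | apply: oppr_inj; rewrite oppr0]).
  by [].
by have /eqP := nondeg (fun i => if i == 0%N then 1 else 0) e0 0%N isT; rewrite oner_eq0.
Qed.

(** * A divergence-free field attached to a closed two-form *)

Section DeriveRules.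
Context {R : realType} {V : normedModType R}.
Implicit Types (x v : V).

Lemma smooth_is_derive (W : normedModType R) (U : set V) (f : V -> W) x v :
  smooth_on U f -> U x -> is_derive x v f ('D_v f x).
Proof. by move=> sf Ux; apply/derivableP/diff_derivable; exact: smooth_on_diff sf Ux. Qed.

Lemma is_derive_mul (f g : V -> R) x v (df dg : R) :
  is_derive x v f df -> is_derive x v g dg ->
  is_derive x v (fun y => f y * g y) (df * g x + f x * dg).
Proof.
move=> Df Dg; apply: is_derive_eq (is_deriveM Df Dg) _.
by rewrite addrC /GRing.scale /= [g x * _]mulrC.
Qed.

Lemma is_derive_add (W : normedModType R) (f g : V -> W) x v (df dg : W) :
  is_derive x v f df -> is_derive x v g dg ->
  is_derive x v (fun y => f y + g y) (df + dg).
Proof. exact: is_deriveD. Qed.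

Lemma is_derive_sub (W : normedModType R) (f g : V -> W) x v (df dg : W) :
  is_derive x v f df -> is_derive x v g dg ->
  is_derive x v (fun y => f y - g y) (df - dg).
Proof. exact: is_deriveB. Qed.

Lemma is_derive_bigsum (W : normedModType R) n (h : 'I_n -> V -> W) x v (dh : 'I_n -> W) :
  (forall i, is_derive x v (h i) (dh i)) ->
  is_derive x v (fun y => \sum_(i < n) h i y) (\sum_(i < n) dh i).
Proof.
move=> H; have := is_derive_sum H; rewrite (_ : \sum_(i < n) h i = fun y => \sum_(i < n) h i y) //.
by apply/funext => y; rewrite fct_sumE.
Qed.

Lemma is_derive_mulc (f : V -> R) (c : R) x v (df : R) :
  is_derive x v f df -> is_derive x v (fun y => c * f y) (c * df).
Proof.
move=> Df; apply: is_derive_eq (is_derive_mul (is_derive_cst c x v) Df) _.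
by rewrite mul0r add0r.
Qed.

End DeriveRules.

Lemma is_derive_comp_row (R : realType) (V : normedModType R) (n : nat)
    (p : V -> 'rV[R]_n) (W : normedModType R) (g : 'rV[R]_n -> W) (x v : V) dp :
  differentiable p x -> 'D_v p x = dp -> differentiable g (p x) ->
  is_derive x v (fun y => g (p y)) ('D_dp g (p x)).
Proof.
move=> dpx <- dg; rewrite -derive_comp_row //; apply/derivableP/diff_derivable.
exact: (@differentiable_comp _ _ _ _ p g).
Qed.

Section ConeField.
Context {R : realType}.
Local Notation e := (fun i : nat => unit_vec R (inord i : 'I_6)).
Context (B : nat -> nat -> 'rV[R]_6 -> R).
Local Notation form_at y := (fun a c : nat => B a c y).
Context (sB : forall i j, smooth_on setT (B i j)).
Context (skewB : forall i j y, B i j y = - B j i y).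
Context (closedB : forall i j k y,
  'D_(e i) (B j k) y + 'D_(e j) (B k i) y + 'D_(e k) (B i j) y = 0).

(** Points of R^7 are pairs (t, y), the time t being the coordinate [ord0]. *)
Definition spatial (z : 'rV[R]_7) : 'rV[R]_6 := \row_i z ord0 (lift ord0 i).
Definition cone (z : 'rV[R]_7) : 'rV[R]_6 := z ord0 ord0 *: spatial z.

Lemma smooth_space : smooth_on setT spatial.
Proof.
apply/(smooth_on_mxP openT) => i j.
apply: (smooth_on_ext openT) (_ : smooth_on setT (fun z : 'rV[R]_7 => z ord0 (lift ord0 j))).
  by move=> z _; rewrite mxE.
exact: ((smooth_on_mxP openT _).1 (smooth_on_id openT)).
Qed.

Lemma smooth_time : smooth_on setT (fun z : 'rV[R]_7 => z ord0 ord0).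
Proof. exact: ((smooth_on_mxP openT _).1 (smooth_on_id openT)). Qed.

Lemma smooth_cone : smooth_on setT cone.
Proof. exact: (smooth_on_scale openT smooth_time smooth_space). Qed.

Lemma derive_space z v : 'D_v spatial z = spatial v.
Proof.
apply/rowP => i; rewrite derive_entry; last exact: (smooth_diff _ smooth_space).
rewrite mxE -(derive_coord z); congr ('D_v _ z).
by apply/funext => y; rewrite mxE.
Qed.

Lemma derive_cone z v :
  'D_v cone z = v ord0 ord0 *: spatial z + z ord0 ord0 *: spatial v.
Proof.
apply/rowP => i; rewrite derive_entry; last exact: (smooth_diff _ smooth_cone).
have D1 := smooth_is_derive v smooth_time (I : setT z).
have D2 := smooth_is_derive v
  ((smooth_on_mxP openT _).1 smooth_space ord0 i) (I : setT z).
have D := is_derive_mul D1 D2.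
have -> : (fun y => cone y ord0 i) = (fun y => y ord0 ord0 * spatial y ord0 i).
  by apply/funext => y; rewrite mxE.
rewrite (@derive_val _ _ _ _ _ _ _ D) -(derive_entry (F := spatial)); last first.
  exact: (smooth_diff _ smooth_space).
by rewrite derive_space derive_coord !mxE.
Qed.

Lemma is_derive_space (f : 'rV[R]_6 -> R) z v : smooth_on setT f ->
  is_derive z v (fun z => f (spatial z)) ('D_(spatial v) f (spatial z)).
Proof.
move=> sf; apply: is_derive_comp_row; last exact: (smooth_diff _ sf).
  exact: (smooth_diff _ smooth_space).
exact: derive_space.
Qed.

Lemma is_derive_cone (f : 'rV[R]_6 -> R) z v : smooth_on setT f ->
  is_derive z v (fun z => f (cone z))
    ('D_(v ord0 ord0 *: spatial z + z ord0 ord0 *: spatial v) f (cone z)).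
Proof.
move=> sf; apply: is_derive_comp_row; last exact: (smooth_diff _ sf).
  exact: (smooth_diff _ smooth_cone).
exact: derive_cone.
Qed.

Lemma smooth_padj i j : smooth_on setT (fun y => padj (form_at y) i j).
Proof.
have oT := @openT 'rV[R]_6.
rewrite /padj /pf4; apply: smooth_onM => //; first exact: smooth_on_cst.
by do ![apply: (smooth_onD oT) | apply: (smooth_onN oT) | apply: (smooth_onM oT)].
Qed.

Lemma derive_padj i j (w : 'rV[R]_6) y :
  'D_w (fun y => padj (form_at y) i j) y =
  padj_polar (form_at y) (fun a b => 'D_w (B a b) y) i j.
Proof.
have D a b := smooth_is_derive w (sB a b) (I : setT y).
rewrite /padj /pf4 /padj_polar /pf4_polar; set o := others i j.
apply: derive_val; apply: is_derive_mulc; apply: is_derive_add.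
  by apply: is_derive_sub; exact: is_derive_mul.
exact: is_derive_mul.
Qed.

(** The components of the vector field dual to the six-form h^*B /\ (B /\ B) / 2, where
    h is [cone]. Its time component contracts t^2 B (t y) with the Pfaffian adjugate of
    B (y); in the spatial components, the one-form t B (t y) (y, _) takes the place of
    h^*B. *)
Definition time_field (z : 'rV[R]_7) : R :=
  2^-1 * \sum_(i < 6) \sum_(j < 6)
    z ord0 ord0 * (z ord0 ord0 * (B i j (cone z) * padj (form_at (spatial z)) i j)).

Definition space_field (k : nat) (z : 'rV[R]_7) : R :=
  \sum_(j < 6) (z ord0 ord0 * \sum_(l < 6) spatial z ord0 l * B l j (cone z))
    * padj (form_at (spatial z)) j k.

Definition cone_field (k : 'I_7) : 'rV[R]_7 -> R :=
  if unlift ord0 k is Some i then space_field i else time_field.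

Lemma smooth_cone_field k : smooth_on setT (cone_field k).
Proof.
have oT := @openT 'rV[R]_7.
have sb i j : smooth_on setT (fun z => B i j (cone z)).
  exact: (smooth_on_comp oT (U' := setT) (fun _ _ => I) smooth_cone (sB i j)).
have sp i j : smooth_on setT (fun z => padj (form_at (spatial z)) i j).
  exact: (smooth_on_comp oT (U' := setT) (fun _ _ => I) smooth_space (smooth_padj i j)).
have st := smooth_time.
rewrite /cone_field; case: (unlift ord0 k) => [i|].
  apply: smooth_on_sum => // j; apply: smooth_onM => //; apply: smooth_onM => //.
  apply: smooth_on_sum => // l; apply: smooth_onM => //.
  exact: ((smooth_on_mxP oT _).1 smooth_space).
apply: smooth_onM => //; first exact: smooth_on_cst.
apply: smooth_on_sum => // i; apply: smooth_on_sum => // j.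
by do 3 apply: smooth_onM => //.
Qed.

Lemma space_unit0 : spatial (unit_vec R ord0) = 0.
Proof. by apply/rowP => i; rewrite /unit_vec !mxE andbF. Qed.

Lemma space_unit_lift k : spatial (unit_vec R (lift ord0 k)) = unit_vec R k.
Proof. by apply/rowP => i; rewrite /unit_vec !mxE (inj_eq lift_inj). Qed.

Local Notation b z i j := (B i j (cone z)).
Local Notation p z := (padj (form_at (spatial z))).

Lemma derive_time_field z :
  'D_(unit_vec R ord0) time_field z =
  2^-1 * \sum_(i < 6) \sum_(j < 6) (2 * z ord0 ord0 * b z i j
    + z ord0 ord0 ^+ 2 * \sum_(l < 6) spatial z ord0 l * 'D_(e l) (B i j) (cone z)) * p z i j.
Proof.
apply: derive_val; apply: is_derive_mulc; apply: is_derive_bigsum => i.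
apply: is_derive_bigsum => j.
have Dt : is_derive z (unit_vec R ord0) (fun z : 'rV[R]_7 => z ord0 ord0) 1.
  apply: is_derive_eq (smooth_is_derive _ smooth_time (I : setT z)) _.
  by rewrite derive_coord mxE !eqxx.
have Dp := is_derive_space z (unit_vec R ord0) (smooth_padj i j).
have Db := is_derive_cone z (unit_vec R ord0) (sB i j).
apply: is_derive_eq (is_derive_mul Dt (is_derive_mul Dt (is_derive_mul Db Dp))) _.
rewrite space_unit0 derive0 scaler0 addr0 /unit_vec mxE !eqxx scale1r.
rewrite derive_row_sum; last exact: (smooth_diff _ (sB i j)).
set S1 := \sum_(l < 6) _; set S2 := \sum_(l < 6) _.
have -> : S1 = S2 by apply: eq_bigr => l _; rewrite /unit_vec inord_val.
by ring.
Qed.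

Lemma derive_space_field (k : 'I_6) z :
  'D_(unit_vec R (lift ord0 k)) (space_field k) z =
  \sum_(j < 6) (z ord0 ord0 * (b z k j + z ord0 ord0 *
     \sum_(l < 6) spatial z ord0 l * 'D_(e k) (B l j) (cone z)) * p z j k +
    (z ord0 ord0 * \sum_(l < 6) spatial z ord0 l * b z l j) *
      padj_polar (form_at (spatial z)) (fun a c => 'D_(e k) (B a c) (spatial z)) j k).
Proof.
apply: derive_val; apply: is_derive_bigsum => j.
set u := unit_vec R (lift ord0 k).
have Dt : is_derive z u (fun z : 'rV[R]_7 => z ord0 ord0) 0.
  apply: is_derive_eq (smooth_is_derive _ smooth_time (I : setT z)) _.
  by rewrite derive_coord mxE.
have Dp := is_derive_space z u (smooth_padj j k).
have Dy l : is_derive z u (fun z => spatial z ord0 l) (k == l)%:R.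
  apply: is_derive_eq (smooth_is_derive _
    ((smooth_on_mxP openT _).1 smooth_space ord0 l) (I : setT z)) _.
  rewrite -(derive_entry (F := spatial)); last exact: (smooth_diff _ smooth_space).
  by rewrite derive_space /u space_unit_lift /unit_vec mxE eqxx eq_sym.
have Db l := is_derive_cone z u (sB l j).
have DS := is_derive_bigsum (fun l : 'I_6 => is_derive_mul (Dy l) (Db l)).
apply: is_derive_eq (is_derive_mul (is_derive_mul Dt DS) Dp) _.
rewrite derive_padj /u space_unit_lift mul0r add0r inord_val; congr (_ * _ + _).
congr (_ * _); rewrite big_split /= (bigD1 k) //= eqxx mul1r big1 => [|l lk]; last first.
  by rewrite eq_sym (negPf lk) mul0r.
rewrite addr0; congr (_ + _); rewrite mulr_sumr; apply: eq_bigr => l _.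
rewrite !mxE /= scale0r add0r mulrCA; congr (_ * _).
rewrite !deriveE; try exact: (smooth_diff _ (sB l j)).
by rewrite linearZ.
Qed.

(** The six-form is closed. Both sources of spatial gradient are controlled by the
    closedness of B: the gradient of the adjugate contributes nothing by
    [padj_polar_div], and the time derivative of t^2 B (t y) is the exterior derivative
    of the one-form t B (t y) (y, _). *)
Lemma div_cone_field z : \sum_k 'D_(unit_vec R k) (cone_field k) z = 0.
Proof.
have cf0 : cone_field ord0 = time_field by rewrite /cone_field unlift_none.
have cfS (k : 'I_6) : cone_field (lift ord0 k) = space_field k by rewrite /cone_field liftK.
rewrite big_ord_recl cf0 derive_time_field.
under [X in _ + X]eq_bigr => k _ do rewrite cfS derive_space_field.
set t := z ord0 ord0; set y := spatial z.
pose D l i j : R := 'D_(e l) (B i j) (cone z).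
have Dc l i j : D l i j = D i l j - D j l i.
  have := closedB l i j (cone z); rewrite -/(D l i j) -/(D i j l) -/(D j l i).
  have -> : D i j l = - D i l j.
    rewrite /D (_ : B j l = - B l j); last by apply/funext => x; rewrite skewB.
    by rewrite deriveN //; apply/diff_derivable; exact: (smooth_diff _ (sB l j)).
  by move=> /eqP; rewrite -addrA addr_eq0 opprD opprK => /eqP.
have -> : \sum_(k < 6) \sum_(j < 6) (t * (b z k j + t * \sum_(l < 6) y ord0 l * D k l j) * p z j k +
    (t * \sum_(l < 6) y ord0 l * b z l j) *
      padj_polar (form_at y) (fun a c => 'D_(e k) (B a c) y) j k) =
   \sum_(k < 6) \sum_(j < 6) t * (b z k j + t * \sum_(l < 6) y ord0 l * D k l j) * p z j k.
  under eq_bigr => k _ do rewrite big_split /=.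
  rewrite big_split /= [X in _ + X]exchange_big /= [X in _ + X]big1 ?addr0 // => j _.
  rewrite -mulr_sumr (padj_polar_div _ (D := fun k a c => 'D_(e k) (B a c) y)) ?mulr0 //.
    move=> k a c; rewrite (_ : B a c = - B c a); last by apply/funext => x; rewrite skewB.
    by rewrite deriveN //; apply/diff_derivable; exact: (smooth_diff _ (sB c a)).
have pE i j : p z j i = - p z i j := padj_skew _ i j.
have sym (F : 'I_6 -> 'I_6 -> R) : \sum_(i < 6) \sum_(j < 6) F j i * p z i j =
    - \sum_(i < 6) \sum_(j < 6) F i j * p z i j.
  rewrite exchange_big -sumrN; apply: eq_bigr => i _; rewrite -sumrN.
  by apply: eq_bigr => j _; rewrite pE mulrN.
have half (x : R) : 2^-1 * (x + x) = x by lra.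
pose S (F : 'I_6 -> 'I_6 -> R) := \sum_(i < 6) \sum_(j < 6) F i j * p z i j.
(* [F1] is the time derivative of the form, [F2] the matrix of partial derivatives of
   the one-form. *)
pose F1 (i j : 'I_6) := 2 * t * b z i j + t ^+ 2 * \sum_(l < 6) y ord0 l * D l i j.
pose F2 (i j : 'I_6) := t * (b z i j + t * \sum_(l < 6) y ord0 l * D i l j).
have F12 i j : F1 i j = F2 i j - F2 j i.
  rewrite /F1 /F2 (skewB j i).
  have -> : \sum_(l < 6) y ord0 l * D l i j =
      \sum_(l < 6) y ord0 l * D i l j - \sum_(l < 6) y ord0 l * D j l i.
    by rewrite -sumrB; apply: eq_bigr => l _; rewrite Dc mulrBr.
  by ring.
have -> : \sum_(k < 6) \sum_(j < 6) t * (b z k j + t * \sum_(l < 6) y ord0 l * D k l j) * p z j k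
   = - S F2.
  rewrite /S -sumrN; apply: eq_bigr => i _; rewrite -sumrN; apply: eq_bigr => j _.
  by rewrite pE mulrN.
rewrite -[X in 2^-1 * X + _]/(S F1).
have -> : S F1 = S F2 + S F2.
  rewrite -{2}[S F2]opprK -(sym F2) /S -sumrB; apply: eq_bigr => i _.
  by rewrite -sumrB; apply: eq_bigr => j _; rewrite F12 mulrBl.
by rewrite half subrr.
Qed.

End ConeField.

(** * Closed forms on the cube that vanish on its boundary degenerate inside *)

Section NoForm.
Context {R : realType}.
Local Notation e := (fun i : nat => unit_vec R (inord i : 'I_6)).
Context (B : nat -> nat -> 'rV[R]_6 -> R).
Local Notation form_at y := (fun a c : nat => B a c y).
Context (sB : forall i j, smooth_on setT (B i j)).
Context (skewB : forall i j y, B i j y = - B j i y).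
Context (closedB : forall i j k y,
  'D_(e i) (B j k) y + 'D_(e j) (B k i) y + 'D_(e k) (B i j) y = 0).
Context (boundaryB : forall (y : 'rV[R]_6) k, cube y -> y ord0 k = 0 \/ y ord0 k = 1 ->
  forall i j, B i j y = 0).
Context (nondegB : forall y : 'rV[R]_6, (forall i, 0 < y ord0 i < 1) ->
  forall v : nat -> R, (forall j, (j < 6)%N -> \sum_(i < 6) v i * B i j y = 0) ->
  forall i, (i < 6)%N -> v i = 0).

Local Notation Pf := (fun y => pfaffian6 (form_at y)).

Lemma form_diag i y : B i i y = 0.
Proof. by have := skewB i i y; lra. Qed.

Lemma smooth_pfaffian : smooth_on setT Pf.
Proof.
have oT := @openT 'rV[R]_6.
apply: smooth_on_sum => // j; apply: smooth_onM => //; exact: smooth_padj.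
Qed.

Lemma pfaffian_interior_neq0 (y : 'rV[R]_6) : (forall i, 0 < y ord0 i < 1) -> Pf y != 0.
Proof.
move=> yin; apply: pfaffian6_neq0 => [i j|i|]; first exact: skewB.
  exact: form_diag.
exact: nondegB yin.
Qed.

Lemma time_field_1 (z : 'rV[R]_7) : z ord0 ord0 = 1 -> time_field B z = 3 * Pf (spatial z).
Proof.
move=> z1; rewrite /time_field /cone z1 scale1r.
have -> : \sum_(i < 6) \sum_(j < 6) 1 * (1 * (B i j (spatial z) * padj (form_at (spatial z)) i j))
   = \sum_(i < 6) Pf (spatial z).
  apply: eq_bigr => i _; under eq_bigr do rewrite !mul1r.
  rewrite (mul_padj (B := form_at (spatial z))) ?eqxx //.
  by move=> a; exact: form_diag.
by rewrite sumr_const card_ord -mulr_natr; lra.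
Qed.

Lemma time_field_0 (z : 'rV[R]_7) : z ord0 ord0 = 0 -> time_field B z = 0.
Proof.
move=> z0; rewrite /time_field z0 big1 ?mulr0 // => i _; rewrite big1 // => j _.
by rewrite mul0r.
Qed.

Lemma space_field_boundary m (z : 'rV[R]_7) k : cube z ->
  z ord0 (lift ord0 k) = 0 \/ z ord0 (lift ord0 k) = 1 -> space_field B m z = 0.
Proof.
move=> cz zk; rewrite /space_field big1 // => j _.
have b0 i l : B i l (spatial z) = 0.
  apply: (@boundaryB _ k); last by rewrite mxE.
  by move=> a; rewrite mxE.
by rewrite /padj /pf4 !b0 !mulr0 !addr0 subr0 !mulr0.
Qed.

Lemma set_coord_cube n (z : 'rV[R]_n) k a : cube z -> 0 <= a <= 1 -> cube (set_coord z k a).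
Proof. by move=> cz a01 i; rewrite mxE; case: ifP. Qed.

(** Only the face t = 1 contributes: the field vanishes for t = 0, and on the lateral
    faces because B does. *)
Lemma flux_cone_field M :
  \sum_(k < 7) \sum_(q : {ffun 'I_7 -> 'I_M.+1} | q k == ord_max)
    (cone_field B k (set_coord (grid_pt q) k 1) - cone_field B k (set_coord (grid_pt q) k 0)) =
  \sum_(q : {ffun 'I_7 -> 'I_M.+1} | q ord0 == ord_max) 3 * Pf (spatial (grid_pt q)).
Proof.
rewrite big_ord_recl [X in _ + X]big1 ?addr0 => [|k _]; last first.
  rewrite big1 // => q _; rewrite /cone_field liftK.
  by rewrite !(@space_field_boundary _ _ k) ?subrr //;
    try (by apply: set_coord_cube; [exact: grid_pt_cube|rewrite ?lexx ?ler01]);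
    rewrite !mxE eqxx; [left|right].
apply: eq_bigr => q _; rewrite /cone_field unlift_none.
rewrite time_field_1 ?mxE // time_field_0 ?mxE // subr0; congr (3 * pfaffian6 _).
apply/funext => i; apply/funext => j; congr (B i j _).
by apply/rowP => a; rewrite !mxE.
Qed.

(** The open cube is connected and the Pfaffian does not vanish there. *)
Lemma pfaffian_sign (y0 y : 'rV[R]_6) : (forall i, 0 < y0 ord0 i < 1) ->
  (forall i, 0 < y ord0 i < 1) -> 0 < Pf y0 * Pf y.
Proof.
move=> y0in yin; rewrite lt_def mulf_neq0 ?pfaffian_interior_neq0 //=.
rewrite leNgt; apply/negP => neg.
have cont : continuous Pf.
  by move=> x; apply: differentiable_continuous; exact: (smooth_diff _ smooth_pfaffian).
pose f (s : R) := Pf (y0 + s *: (y - y0)).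
have df s : derivable f s 1.
  by have [] := is_derive_line (smooth_diff (y0 + s *: (y - y0)) smooth_pfaffian).
have cf : {within `[0, 1], continuous f}.
  by apply: derivable_within_continuous => s _; exact: df.
have f0 : f 0 = Pf y0 by rewrite /f scale0r addr0.
have f1 : f 1 = Pf y by rewrite /f scale1r addrC subrK.
have [|s] := IVT ler01 cf (v := 0).
  rewrite f0 f1; case: (ltgtP (Pf y0) 0) => s0.
  - have s1 : 0 < Pf y by rewrite -(nmulr_rlt0 _ s0).
    by rewrite ge_min (ltW s0) /= le_max (ltW s1) orbT.
  - have s1 : Pf y < 0 by rewrite -(pmulr_rlt0 _ s0).
    by rewrite ge_min (ltW s1) orbT /= le_max (ltW s0).
  - by rewrite s0 mul0r ltxx in neg.
rewrite in_itv /= => /andP[s0 s1] fs0.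
have /eqP := fs0; apply/negP/pfaffian_interior_neq0 => i.
rewrite !mxE; have /andP[a0 a1] := y0in i; have /andP[b0 b1] := yin i.
have conv (a b : R) : 0 < a -> 0 < b -> 0 < (1 - s) * a + s * b.
  move=> a_gt0 b_gt0; have := mulr_ge0 s0 (ltW b_gt0).
  have : 0 <= (1 - s) * a by rewrite mulr_ge0 ?subr_ge0 // ltW.
  case: (lerP s 2^-1) => s2.
    have : 0 <= (2^-1 - s) * a by rewrite mulr_ge0 ?subr_ge0 // ltW.
    lra.
  have : 0 < (s - 2^-1) * b by rewrite mulr_gt0 ?subr_gt0.
  lra.
have := conv _ _ a0 b0; rewrite -subr_gt0 in a1; rewrite -subr_gt0 in b1.
have := conv _ _ a1 b1; lra.
Qed.

Let center : 'rV[R]_6 := \row_i 2^-1.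

Lemma center_interior i : 0 < center ord0 i < 1.
Proof. by rewrite mxE; lra. Qed.

Lemma pfaffian_ge0 y : cube y -> 0 <= Pf center * Pf y.
Proof.
move=> cy; have [yin|] := pselect (forall i, 0 < y ord0 i < 1).
  by apply/ltW/pfaffian_sign => //; exact: center_interior.
move=> /existsNP[k /negP]; have /andP[y0 y1] := cy k.
rewrite negb_and -!leNgt => H.
have yk : y ord0 k = 0 \/ y ord0 k = 1.
  by case/orP: H => H; [left|right]; apply/eqP; rewrite eq_le ?H ?y0 ?y1.
have b0 := boundaryB cy yk.
rewrite [pfaffian6 (form_at y)]big1 ?mulr0 // => j _; by rewrite b0 mul0r.
Qed.

Lemma pfaffian_lower : exists2 c, 0 < c &
  forall y : 'rV[R]_6, (forall i, 4^-1 <= y ord0 i <= 2^-1) -> c <= Pf center * Pf y.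
Proof.
pose K : set 'rV[R]_6 := [set y | forall i, 4^-1 <= y ord0 i <= 2^-1].
have cK : compact K.
  have -> : K = [set z | forall i, (`[4^-1, 2^-1]%classic : set R) (z ord0 i)].
    by apply/seteqP; split => z /= Hz i; have := Hz i; rewrite in_itv.
  apply: (@rV_compact R 6 (fun=> `[4^-1, 2^-1]%classic)) => i; exact: segment_compact.
have K0 : K !=set0 by exists center => i; rewrite mxE; lra.
have [|c Kc Hc] := @EVT_min_rV R 6 (fun y => Pf center * Pf y) K K0 cK.
  apply: continuous_subspaceT => z; apply: differentiable_continuous.
  apply: smooth_diff; apply: smooth_onM => //;
    [exact: openT|exact: smooth_on_cst openT _ _|exact: smooth_pfaffian].
exists (Pf center * Pf c).
  apply: pfaffian_sign; first exact: center_interior.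
  by move=> i; move: Kc; rewrite inE => /(_ i); lra.
by move=> y Ky; apply: Hc; rewrite inE.
Qed.

Lemma sum_window m :
  \sum_(j < (4 * m + 3).+1) (if (m.+1 <= j < 2 * m.+1)%N then 1 else 0 : R) = m.+1%:R.
Proof.
rewrite -(big_mkord xpredT (fun j => if (m.+1 <= j < 2 * m.+1)%N then 1 else 0 : R)).
rewrite (big_cat_nat (n := m.+1)) //=; last by lia.
rewrite [X in _ + X](big_cat_nat (n := (2 * m.+1)%N)) /=; try lia.
rewrite [X in X + _]big_nat_cond [X in X + _]big1 ?add0r => [|j]; last first.
  by rewrite andbT => /andP[_ jm]; rewrite ifF // leqNgt jm.
rewrite [X in _ + X]big_nat_cond [X in _ + X]big1 ?addr0 => [|j]; last first.
  by rewrite andbT => /andP[jm _]; rewrite ifF // [(j < 2 * _)%N]ltnNge jm andbF.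
rewrite (eq_big_nat _ _ (F2 := fun=> 1)) => [|j ->] //.
by rewrite sumr_const_nat; congr (_ *+ _); lia.
Qed.

(** The grid points with all coordinates in [1/4, 1/2] make up a fixed proportion of the
    face, and the Pfaffian is bounded away from zero at these points. They are counted
    by expanding a product of sums of weights [w], one for each coordinate. *)
Lemma pfaffian_sum_lower : exists2 c, 0 < c & forall m,
  c * m.+1%:R ^+ 6 <= \sum_(q : {ffun 'I_7 -> 'I_(4 * m + 3).+1} | q ord0 == ord_max)
    (Pf center * Pf (spatial (grid_pt q))).
Proof.
have [c c0 Hc] := pfaffian_lower; exists c => // m.
set N := (4 * m + 3)%N.
pose w (k : 'I_7) (j : 'I_N.+1) : R :=
  if k == ord0 then if j == ord_max then 1 else 0
  else if (m.+1 <= j < 2 * m.+1)%N then 1 else 0.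
have wsum : \sum_(q : {ffun 'I_7 -> 'I_N.+1}) \prod_k w k (q k) = m.+1%:R ^+ 6.
  rewrite -(bigA_distr_bigA w) big_ord_recl /w eqxx -big_mkcond /= big_pred1_eq mul1r.
  by under eq_bigr do rewrite sum_window; rewrite prodr_const card_ord.
rewrite -wsum mulr_sumr [leRHS]big_mkcond; apply: ler_sum => q _.
rewrite big_ord_recl /w eqxx; case: ifP => [qm|_]; last by rewrite mul0r mulr0.
rewrite mul1r; case: (boolP [forall k : 'I_6, (m.+1 <= q (lift ord0 k) < 2 * m.+1)%N]).
  move=> /forallP H; rewrite big1 ?mulr1 => [|k _]; last by rewrite /= H.
  apply: Hc => i; rewrite !mxE; have /andP[q1 q2] := H i.
  have N4 : N.+1%:R = 4 * m.+1%:R :> R by rewrite -natrM; congr (_%:R); rewrite /N; lia.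
  rewrite N4; have m0 : 0 < m.+1%:R :> R by rewrite ltr0n.
  rewrite ler_pdivlMr ?ler_pdivrMr ?mulr_gt0 //.
  have : m.+1%:R <= (q (lift ord0 i))%:R :> R by rewrite ler_nat.
  have : (q (lift ord0 i))%:R <= 2 * m.+1%:R :> R by rewrite -natrM ler_nat ltnW.
  by move=> ? ?; apply/andP; split; lra.
move=> /forallPn[k kH]; rewrite (bigD1 k) //= (negPf kH) mul0r mulr0.
by apply: pfaffian_ge0 => i; rewrite mxE; exact: grid_pt_cube.
Qed.

(** With 4 (m + 1) grid points per edge, the flux is at least of the order of m^6 by the
    lower bound on the Pfaffian, and at most of the order of m^5 by the divergence
    theorem. *)
Theorem no_nondegenerate_closed_form : False.
Proof.
have [C C0 HC] := grid_divergence (smooth_cone_field sB)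
  (div_cone_field sB skewB closedB).
have [c c0 Hc] := pfaffian_sum_lower.
pose A := `|Pf center| * C * 4 ^+ 5.
have key m : 3 * c * m.+1%:R <= A.
  have m0 : 0 < m.+1%:R :> R by rewrite ltr0n.
  have := HC (4 * m + 3)%N; rewrite flux_cone_field -mulr_sumr.
  set S := \sum_(q | _) _ => HS; have := Hc m; rewrite -mulr_sumr -/S => HcS.
  have N4 : (4 * m + 3).+1%:R = 4 * m.+1%:R :> R by rewrite -natrM; congr (_%:R); lia.
  rewrite N4 in HS.
  have E : C * (4 * m.+1%:R) ^+ 7 / (4 * m.+1%:R) ^+ 2 = C * 4 ^+ 5 * m.+1%:R ^+ 5.
    by field; rewrite lt0r_neq0.
  rewrite E in HS.
  have H1 : 3 * (c * m.+1%:R ^+ 6) <= `|Pf center| * (C * 4 ^+ 5 * m.+1%:R ^+ 5).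
    apply: (@le_trans _ _ (`|Pf center| * `|3 * S|)); last by rewrite ler_wpM2l.
    rewrite -normrM; apply: le_trans (ler_norm _).
    by rewrite [leRHS]mulrCA ler_wpM2l.
  rewrite -(ler_pM2r (exprn_gt0 5 m0)) /A.
  apply: le_trans (le_trans H1 _); first by rewrite exprS !mulrA.
  by rewrite !mulrA.
have := key (Num.trunc (A / (3 * c))); apply/negP; rewrite -ltNge.
by rewrite mulrC -ltr_pdivrMr ?mulr_gt0 // truncnS_gt.
Qed.

End NoForm.

(** * Symmetry of second derivatives *)

(** Two continuous functions agree at [x] if they agree at points arbitrarily close to
    [x], not necessarily the same for both. *)
Lemma eq_of_close (R : realType) (V : normedModType R) (F G : V -> R) (x u v : V) :
  {for x, continuous F} -> {for x, continuous G} ->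
  (forall h, 0 < h -> exists c d c' d', [/\ 0 <= c <= h, 0 <= d <= h,
    0 <= c' <= h, 0 <= d' <= h &
    F (x + c *: u + d *: v) = G (x + c' *: u + d' *: v)]) ->
  F x = G x.
Proof.
move=> cF cG H; apply/eqP; rewrite -subr_eq0 -normr_eq0 eq_le normr_ge0 andbT.
apply/ler_addgt0Pr => eps eps0; rewrite add0r; have e2 : 0 < eps / 2 by rewrite divr_gt0.
move/cvgrPdist_lt : cF => /(_ _ e2) /nbhs_ballP [r1 /= r10 Hr1].
move/cvgrPdist_lt : cG => /(_ _ e2) /nbhs_ballP [r2 /= r20 Hr2].
set S := `|u| + `|v| + 1; have S0 : 0 < S by rewrite ltr_wpDl ?addr_ge0.
pose r := Num.min r1 r2; have r0 : 0 < r by rewrite lt_min r10 r20.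
have h0 : 0 < r / 2 / S by rewrite !divr_gt0.
have near c d : 0 <= c <= r / 2 / S -> 0 <= d <= r / 2 / S ->
    `|x - (x + c *: u + d *: v)| < r.
  move=> /andP[c0 ch] /andP[d0 dh]; rewrite -addrA opprD addrA subrr sub0r normrN.
  apply: (le_lt_trans (ler_normD _ _)); rewrite !normrZ !ger0_norm //.
  apply: (@le_lt_trans _ _ (r / 2 / S * S)); last first.
    by rewrite divfK ?lt0r_neq0 //; lra.
  rewrite /S !mulrDr mulr1; apply: (@le_trans _ _ (r / 2 / S * `|u| + r / 2 / S * `|v|)).
    by apply: lerD; apply: ler_wpM2r.
  by rewrite lerDl ltW.
have [c [d [c' [d' [Hc Hd Hc' Hd' E]]]]] := H _ h0.
have A : `|F x - F (x + c *: u + d *: v)| < eps / 2.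
  apply: Hr1; rewrite -ball_normE /=; apply: lt_le_trans (near _ _ Hc Hd) _.
  by rewrite ge_min lexx.
have A' : `|G x - G (x + c' *: u + d' *: v)| < eps / 2.
  apply: Hr2; rewrite -ball_normE /=; apply: lt_le_trans (near _ _ Hc' Hd') _.
  by rewrite ge_min lexx orbT.
have -> : F x - G x = (F x - F (x + c *: u + d *: v)) - (G x - G (x + c' *: u + d' *: v)).
  by rewrite E; ring.
apply: (le_trans (ler_normB _ _)); lra.
Qed.

(** The mean value theorem, applied to the increment of [f] in direction [v] and then to
    its derivative in direction [u], expresses the second difference of [f], which is
    symmetric in [u] and [v], as a mixed second derivative at a nearby point. *)
Lemma mixed_difference (R : realType) (V : normedModType R) (f : V -> R) (x u v : V) (h : R) :
  smooth_on setT f -> 0 < h ->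
  exists c d, [/\ 0 <= c <= h, 0 <= d <= h &
    f (x + h *: u + h *: v) - f (x + h *: u) - f (x + h *: v) + f x =
      h * (h * 'D_v ('D_u f) (x + c *: u + d *: v))].
Proof.
move=> sf h0; have oT := @openT V; have h0' := ltW h0.
pose g y := f (y + h *: v) - f y.
have dsh y : differentiable (fun y => y + h *: v) y.
  by apply: differentiableD => //; exact: differentiable_cst.
have dfs y : differentiable (fun y => f (y + h *: v)) y.
  by apply: (@differentiable_comp _ _ _ _ _ f) => //; exact: smooth_diff.
have dg y : differentiable g y by apply: differentiableB => //; exact: smooth_diff.
have Dg y : 'D_u g y = 'D_u f (y + h *: v) - 'D_u f y.
  rewrite /g deriveB; try by apply: diff_derivable => //; exact: smooth_diff.
  congr (_ - _); rewrite -[LHS]/('D_u (f \o (fun y => y + h *: v)) y).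
  rewrite deriveE; last by apply: differentiable_comp => //; exact: smooth_diff.
  rewrite diff_comp //=; last exact: smooth_diff.
  rewrite -[X in 'd f _ X]deriveE // deriveD; [|exact: derivable_id|exact: derivable_cst].
  rewrite derive_id derive_cst addr0 deriveE //; exact: smooth_diff.
have [c ch Ec] := line_MVT x u h0' dg.
have [d dh Ed] := line_MVT (x + c *: u) v h0'
  (fun y => smooth_diff y (smooth_on_derive u sf)).
exists c, d; split => //; rewrite -Ed -Dg -Ec /g.
by ring.
Qed.

Lemma derive_swap (R : realType) (V : normedModType R) (f : V -> R) (x u v : V) :
  smooth_on setT f -> 'D_v ('D_u f) x = 'D_u ('D_v f) x.
Proof.
move=> sf; have cont a b : {for x, continuous ('D_a ('D_b f))}.
  by apply: differentiable_continuous; apply: smooth_diff; do 2 apply: smooth_on_derive.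
apply: (@eq_of_close _ _ ('D_v ('D_u f)) ('D_u ('D_v f)) x u v (cont _ _) (cont _ _)) => h h0.
have [c [d [Hc Hd E]]] := mixed_difference x u v sf h0.
have [d' [c' [Hd' Hc' E']]] := mixed_difference x v u sf h0.
exists c, d, c', d'; split; [exact: Hc|exact: Hd|exact: Hc'|exact: Hd'|].
have hn : h != 0 by rewrite lt0r_neq0.
have sw : x + c' *: u + d' *: v = x + d' *: v + c' *: u by rewrite addrAC.
rewrite sw; apply: (mulfI hn); apply: (mulfI hn).
rewrite -[LHS]E -[RHS]E'.
rewrite [x + h *: v + h *: u]addrAC.
move: (f (x + h *: u + h *: v)) (f (x + h *: u)) (f (x + h *: v)) (f x) => a b r s.
by ring.
Qed.

(** * Derivatives of matrix-valued maps *)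

Section MatrixDerive.
Context {R : realType} {V : normedModType R}.

Lemma is_derive_mx (m n : nat) (F : V -> 'M[R]_(m, n)) x v (dF : 'M[R]_(m, n)) :
  (forall i j, is_derive x v (fun y => F y i j) (dF i j)) -> is_derive x v F dF.
Proof.
move=> H; have dv : derivable F x v by apply/derivable_mxP => i j; have [] := H i j.
apply: DeriveDef => //; apply/matrixP => i j; rewrite derive_mx // mxE.
exact: (@derive_val _ _ _ _ _ _ _ (H i j)).
Qed.

Lemma is_derive_entry (m n : nat) (F : V -> 'M[R]_(m, n)) x v (dF : 'M[R]_(m, n)) i j :
  is_derive x v F dF -> is_derive x v (fun y => F y i j) (dF i j).
Proof.
move=> [dv <-]; apply: DeriveDef; first exact: (derivable_mxP _ _ _).1.
by rewrite derive_mx // mxE.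
Qed.

Lemma is_derive_mulmx (a b c : nat) (F : V -> 'M[R]_(a, b)) (G : V -> 'M[R]_(b, c))
    x v dF dG : is_derive x v F dF -> is_derive x v G dG ->
  is_derive x v (fun y => F y *m G y) (dF *m G x + F x *m dG).
Proof.
move=> DF DG; apply: is_derive_mx => i j; rewrite !mxE -big_split /=.
rewrite (_ : (fun y => _) = fun y => \sum_k F y i k * G y k j); last first.
  by apply/funext => y; rewrite mxE.
apply: is_derive_bigsum => k; apply: is_derive_mul; exact: is_derive_entry.
Qed.

Lemma is_derive_mxtrace (a : nat) (F : V -> 'M[R]_a) x v dF :
  is_derive x v F dF -> is_derive x v (fun y => \tr (F y)) (\tr dF).
Proof. by move=> DF; apply: is_derive_bigsum => i; exact: is_derive_entry. Qed.

Lemma is_derive_trmx (a b : nat) (F : V -> 'M[R]_(a, b)) x v dF :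
  is_derive x v F dF -> is_derive x v (fun y => (F y)^T) dF^T.
Proof.
move=> DF; apply: is_derive_mx => i j; rewrite mxE.
rewrite (_ : (fun y => _) = fun y => F y j i); last by apply/funext => y; rewrite mxE.
exact: is_derive_entry.
Qed.

Lemma derive_swap_mx (m n : nat) (F : V -> 'M[R]_(m, n)) x u v :
  smooth_on setT F -> 'D_v ('D_u F) x = 'D_u ('D_v F) x.
Proof.
move=> sF; have oT := @openT V; apply/matrixP => i j.
have sD w : smooth_on setT ('D_w F) by exact: smooth_on_derive.
have E w : (fun y => 'D_w F y i j) = 'D_w (fun y => F y i j).
  by apply/funext => y; apply: derive_entry; exact: smooth_diff.
have E2 w w' : 'D_w' ('D_w F) x i j = 'D_w' ('D_w (fun y => F y i j)) x.
  by rewrite -E; apply: derive_entry; exact: smooth_diff.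
exact: etrans (E2 u v) (etrans (derive_swap x u v ((smooth_on_mxP oT F).1 sF i j))
  (esym (E2 v u))).
Qed.

End MatrixDerive.

(** [A] is twice an idempotent and the [Ai] are tangent at [A] to the variety of such
    matrices, hence exchange the kernel and the image of [A]. A product of three of
    them still exchanges the two, and so has trace zero. *)
Lemma trace_tangent_idempotent (F : fieldType) (n : nat) (A A1 A2 A3 : 'M[F]_n) :
  2%:R != 0 :> F -> A *m A = 2%:R *: A ->
  A *m A1 + A1 *m A = 2%:R *: A1 -> A *m A2 + A2 *m A = 2%:R *: A2 ->
  A *m A3 + A3 *m A = 2%:R *: A3 -> \tr (A1 *m A2 *m A3) = 0.
Proof.
move=> two AA H1 H2 H3.
have l B : A *m B + B *m A = 2%:R *: B -> A *m B = 2%:R *: B - B *m A.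
  by move=> <-; rewrite addrK.
have sand B : A *m B + B *m A = 2%:R *: B -> A *m (B *m A) = 0.
  move=> /l E; rewrite mulmxA E mulmxBl -mulmxA AA -scalemxAl -scalemxAr subrr //.
have X : \tr (A1 *m A2 *m A3 *m A) = 0.
  have E : A *m (A1 *m A2 *m A3 *m A) = 0.
    have E2 : A *m (A2 *m (A3 *m A)) = 2%:R *: (A2 *m (A3 *m A)).
      by rewrite mulmxA (l _ H2) mulmxBl -scalemxAl -mulmxA sand // mulmx0 subr0.
    rewrite -!mulmxA mulmxA (l _ H1) mulmxBl -mulmxA E2 -scalemxAl -scalemxAr subrr //.
  apply: (mulfI two); rewrite mulr0 -mxtraceZ scalemxAr -AA mulmxA mxtrace_mulC.
  by rewrite E mxtrace0.
set T := \tr _; have E1 : 2%:R * T = \tr (A1 *m A2 *m (A *m A3)).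
  rewrite /T -mxtraceZ scalemxAr -H3 mulmxDr mxtraceD.
  by rewrite [A1 *m A2 *m (A3 *m A)]mulmxA X addr0.
rewrite mulmxA -[A1 *m A2 *m A]mulmxA in E1.
have r B : A *m B + B *m A = 2%:R *: B -> B *m A = 2%:R *: B - A *m B.
  by move=> <-; rewrite addrC addKr.
rewrite (r _ H2) mulmxBr mulmxA (r _ H1) -scalemxAr mulmxBl !mulmxBl -!scalemxAl in E1.
rewrite !raddfB /= !mxtraceZ -/T opprK addNKr in E1.
have : 2%:R * T = 0.
  by rewrite E1 -!mulmxA mxtrace_mulC !mulmxA.
by move=> /eqP; rewrite mulf_eq0 (negPf two) => /eqP.
Qed.

(** * The Chern form of a family of complex projections *)

Section ComplexMatrix.
Context {R : realType}.

Definition cmx (m n : nat) (X Y : 'M[R]_(m, n)) : 'M[R[i]]_(m, n) :=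
  complexify X + 'i%C *: complexify Y.

Lemma cmx_mul m n p (X Y : 'M[R]_(m, n)) (Z W : 'M[R]_(n, p)) :
  cmx X Y *m cmx Z W = cmx (X *m Z - Y *m W) (X *m W + Y *m Z).
Proof.
rewrite /cmx /complexify mulmxDl !mulmxDr map_mxB map_mxD !map_mxM -!scalemxAl -!scalemxAr.
rewrite scalerA -expr2 sqr_i scaleN1r scalerDr -!addrA; congr (_ + _).
by rewrite addrA [LHS]addrC.
Qed.

Lemma cmxD m n (X Y Z W : 'M[R]_(m, n)) : cmx X Y + cmx Z W = cmx (X + Z) (Y + W).
Proof. by rewrite /cmx /complexify !map_mxD scalerDr addrACA. Qed.

Lemma cmx_scale2 m n (X Y : 'M[R]_(m, n)) : 2%:R *: cmx X Y = cmx (X + X) (Y + Y).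
Proof. by rewrite -cmxD -mulr2n scaler_nat. Qed.

Lemma cmx_trace n (X Y : 'M[R]_n) : \tr (cmx X Y) = Complex (\tr X) (\tr Y).
Proof.
rewrite /cmx /complexify mxtraceD mxtraceZ !trace_map_mx.
by rewrite [RHS]complexE.
Qed.

End ComplexMatrix.

Section ChernForm.
Context {R : realType} {n : nat}.
Implicit Types (A B C P K X Y : 'M[R]_n).

Definition trace_bracket A B C : R := \tr (A *m (B *m C - C *m B)).

Lemma trace_bracket_skew A B C : trace_bracket A C B = - trace_bracket A B C.
Proof. by rewrite /trace_bracket -[C *m B - _]opprB mulmxN raddfN. Qed.

(** [cmx P K] is twice an idempotent: [K] is a complex structure on the image of the
    projection [P], extended by zero on its kernel. *)
Definition complex_proj P K :=
  [/\ P *m P = P, K *m K = - P, P *m K = K & K *m P = K].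

(** The linearisation of [complex_proj] at [(P, K)] in the direction [(X, Y)]. *)
Definition complex_proj_tangent P K X Y :=
  [/\ X *m P + P *m X = X, Y *m K + K *m Y = - X, X *m K + P *m Y = Y &
      Y *m P + K *m X = Y].

Lemma cmx_idem P K : complex_proj P K -> cmx P K *m cmx P K = 2%:R *: cmx P K.
Proof. by move=> [PP KK PK KP]; rewrite cmx_mul cmx_scale2 PP KK PK KP opprK. Qed.

Lemma cmx_idem_tangent P K X Y : complex_proj_tangent P K X Y ->
  cmx P K *m cmx X Y + cmx X Y *m cmx P K = 2%:R *: cmx X Y.
Proof.
move=> [XP YK XK YP]; rewrite !cmx_mul cmx_scale2 cmxD; congr cmx.
  by rewrite addrACA -opprD [P *m X + _]addrC XP [K *m Y + _]addrC YK opprK.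
by rewrite addrACA [P *m Y + _]addrC XK [K *m X + _]addrC YP.
Qed.

(** The imaginary part of [trace_tangent_idempotent], for the three tangent vectors in
    both cyclic orders. It accounts for the part of the exterior derivative of the
    Chern form that involves no second derivative. *)
Lemma chern_cubic P K X1 Y1 X2 Y2 X3 Y3 :
  complex_proj P K -> complex_proj_tangent P K X1 Y1 ->
  complex_proj_tangent P K X2 Y2 -> complex_proj_tangent P K X3 Y3 ->
  trace_bracket Y1 X2 X3 - trace_bracket Y1 Y2 Y3 + trace_bracket X1 X2 Y3 + trace_bracket X1 Y2 X3 = 0.
Proof.
move=> PK T1 T2 T3; have two : 2%:R != 0 :> R[i] by rewrite pnatr_eq0.
have T Xa Ya Xb Yb : complex_proj_tangent P K Xa Ya -> complex_proj_tangent P K Xb Yb ->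
    \tr (Y1 *m (Xa *m Xb)) - \tr (Y1 *m (Ya *m Yb)) + \tr (X1 *m (Xa *m Yb)) +
    \tr (X1 *m (Ya *m Xb)) = 0.
  move=> Ta Tb; have := trace_tangent_idempotent two (cmx_idem PK)
    (cmx_idem_tangent T1) (cmx_idem_tangent Ta) (cmx_idem_tangent Tb).
  rewrite -mulmxA !cmx_mul cmx_trace => /(congr1 (@complex.Im R)) /= <-.
  rewrite mulmxDr mulmxBr !mxtraceD !raddfN /=; ring.
rewrite /trace_bracket !mulmxBr !mxtraceD !raddfN /=.
by rewrite -[RHS]subr0 -{1}(T _ _ _ _ T2 T3) -(T _ _ _ _ T3 T2); ring.
Qed.

(** Eight times the imaginary part of tr (Q [Q1, Q2]), for Q, Q1 and Q2 the halves of
    [cmx P K], [cmx X Y] and [cmx X' Y']. *)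
Definition chern_alg P K X Y X' Y' : R :=
  trace_bracket K X X' - trace_bracket K Y Y' + trace_bracket P X Y' + trace_bracket P Y X'.

Lemma chern_alg_skew P K X Y X' Y' :
  chern_alg P K X Y X' Y' = - chern_alg P K X' Y' X Y.
Proof.
rewrite /chern_alg (trace_bracket_skew K X X') (trace_bracket_skew K Y Y').
rewrite (trace_bracket_skew P X Y') (trace_bracket_skew P Y X').
by ring.
Qed.

(** The left-hand side is what the product rule gives for the derivative of
    [chern_alg] in a direction [(X, Y)] of the base point; the hypothesis is
    [chern_cubic]. *)
Lemma chern_alg_Leibniz P K X Y X1 Y1 X2 Y2 dX1 dY1 dX2 dY2 :
  trace_bracket Y X1 X2 - trace_bracket Y Y1 Y2 + trace_bracket X X1 Y2 + trace_bracket X Y1 X2 = 0 ->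
  trace_bracket Y X1 X2 + trace_bracket K dX1 X2 + trace_bracket K X1 dX2 -
  (trace_bracket Y Y1 Y2 + trace_bracket K dY1 Y2 + trace_bracket K Y1 dY2) +
  (trace_bracket X X1 Y2 + trace_bracket P dX1 Y2 + trace_bracket P X1 dY2) +
  (trace_bracket X Y1 X2 + trace_bracket P dY1 X2 + trace_bracket P Y1 dX2) =
  chern_alg P K dX1 dY1 X2 Y2 + chern_alg P K X1 Y1 dX2 dY2.
Proof. by move=> Z; rewrite /chern_alg -[RHS]addr0 -Z; ring. Qed.

(** In the cyclic sum that makes up the exterior derivative, the terms with second
    derivatives cancel in pairs, by the symmetry of second derivatives. *)
Lemma chern_alg_cycle (T : Type) P K (X Y : T -> 'M[R]_n) (X2 Y2 : T -> T -> 'M[R]_n) u v w :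
  (forall a b, X2 a b = X2 b a) -> (forall a b, Y2 a b = Y2 b a) ->
  let D a b c := chern_alg P K (X2 a b) (Y2 a b) (X c) (Y c) +
    chern_alg P K (X b) (Y b) (X2 a c) (Y2 a c) in
  D u v w + D v w u + D w u v = 0.
Proof.
move=> sX sY D; rewrite /D (sX v u) (sX w u) (sX w v) (sY v u) (sY w u) (sY w v).
rewrite (chern_alg_skew _ _ (X w)) (chern_alg_skew _ _ (X v)) (chern_alg_skew _ _ (X u)).
by ring.
Qed.

End ChernForm.

Section ChernClosed.
Context {R : realType} {V : normedModType R} {n : nat}.
Context (P K : V -> 'M[R]_n).
Context (sP : smooth_on setT P) (sK : smooth_on setT K).
Context (PK : forall y, complex_proj (P y) (K y)).

Definition chern_form (v w y : V) : R :=
  chern_alg (P y) (K y) ('D_v P y) ('D_v K y) ('D_w P y) ('D_w K y).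

Lemma complex_proj_derive v y : complex_proj_tangent (P y) (K y) ('D_v P y) ('D_v K y).
Proof.
have DP := smooth_is_derive v sP (I : setT y).
have DK := smooth_is_derive v sK (I : setT y).
have rule (F G H : V -> 'M[R]_n) dF dG dH : (forall y, F y *m G y = H y) ->
    is_derive y v F dF -> is_derive y v G dG -> is_derive y v H dH ->
    dF *m G y + F y *m dG = dH.
  move=> FGH DF DG DH; rewrite -(@derive_val _ _ _ _ _ _ _ DH).
  rewrite -(@derive_val _ _ _ _ _ _ _ (is_derive_mulmx DF DG)).
  by congr ('D_v _ y); apply/funext.
split.
- by apply: (rule P P P) => // z; have [] := PK z.
- by apply: (rule K K (fun z => - P z)) => // z; have [] := PK z.
- by apply: (rule P K K) => // z; have [] := PK z.
- by apply: (rule K P K) => // z; have [] := PK z.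
Qed.

Lemma chern_form_skew v w y : chern_form v w y = - chern_form w v y.
Proof. exact: chern_alg_skew. Qed.

Lemma smooth_trace_bracket (A B C : V -> 'M[R]_n) :
  smooth_on setT A -> smooth_on setT B -> smooth_on setT C ->
  smooth_on setT (fun y => trace_bracket (A y) (B y) (C y)).
Proof.
move=> sA sB sC; have oT := @openT V.
apply: (smooth_on_ext oT) (_ : smooth_on setT (fun y =>
  \tr (A y *m (B y *m C y)) + - \tr (A y *m (C y *m B y)))).
  by move=> y _; rewrite /trace_bracket mulmxBr raddfB.
apply: (smooth_onD oT); last apply: (smooth_onN oT).
  by apply: (smooth_on_mxtrace oT); do 2 apply: (smooth_on_mulmx oT) => //.
by apply: (smooth_on_mxtrace oT); do 2 apply: (smooth_on_mulmx oT) => //.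
Qed.

Lemma is_derive_trace_bracket (A B C : V -> 'M[R]_n) y v dA dB dC :
  is_derive y v A dA -> is_derive y v B dB -> is_derive y v C dC ->
  is_derive y v (fun y => trace_bracket (A y) (B y) (C y))
    (trace_bracket dA (B y) (C y) + trace_bracket (A y) dB (C y) + trace_bracket (A y) (B y) dC).
Proof.
move=> DA DB DC.
have D := is_derive_mxtrace (is_derive_mulmx DA
  (is_derive_sub (is_derive_mulmx DB DC) (is_derive_mulmx DC DB))).
apply: is_derive_eq D _.
rewrite /trace_bracket -[RHS]addrA -mxtraceD -mulmxDr -mxtraceD; congr (\tr (_ + _ *m _)).
by rewrite [dC *m _ + _]addrC opprD addrACA.
Qed.

Lemma smooth_chern_form v w : smooth_on setT (chern_form v w).
Proof.
have oT := @openT V.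
rewrite /chern_form /chern_alg.
by do ![apply: (smooth_onD oT) | apply: (smooth_onN oT) | apply: smooth_trace_bracket |
  apply: smooth_on_derive | done].
Qed.

Lemma derive_chern_form u v w y :
  'D_u (chern_form v w) y =
  chern_alg (P y) (K y) ('D_u ('D_v P) y) ('D_u ('D_v K) y) ('D_w P y) ('D_w K y) +
  chern_alg (P y) (K y) ('D_v P y) ('D_v K y) ('D_u ('D_w P) y) ('D_u ('D_w K) y).
Proof.
have D (F : V -> 'M[R]_n) : smooth_on setT F -> is_derive y u F ('D_u F y).
  by move=> sF; exact: smooth_is_derive sF I.
have D1 (F : V -> 'M[R]_n) a : smooth_on setT F -> is_derive y u ('D_a F) ('D_u ('D_a F) y).
  by move=> sF; apply: D; exact: smooth_on_derive.
have := is_derive_add (is_derive_add (is_derive_sub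
  (is_derive_trace_bracket (D _ sK) (D1 _ v sP) (D1 _ w sP))
  (is_derive_trace_bracket (D _ sK) (D1 _ v sK) (D1 _ w sK)))
  (is_derive_trace_bracket (D _ sP) (D1 _ v sP) (D1 _ w sK)))
  (is_derive_trace_bracket (D _ sP) (D1 _ v sK) (D1 _ w sP)).
move=> /(@derive_val _ _ _ _ _ _ _) E; apply: etrans E _.
apply: chern_alg_Leibniz.
exact: chern_cubic (PK y) (complex_proj_derive u y) (complex_proj_derive v y)
  (complex_proj_derive w y).
Qed.

Lemma chern_form_closed u v w y :
  'D_u (chern_form v w) y + 'D_v (chern_form w u) y + 'D_w (chern_form u v) y = 0.
Proof.
have E := derive_chern_form.
apply: etrans (congr2 +%R (congr2 +%R (E u v w y) (E v w u y)) (E w u v y)) _.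
exact: (chern_alg_cycle _ _ (fun a => 'D_a P y) (fun a => 'D_a K y)
  (X2 := fun a b => 'D_a ('D_b P) y) (Y2 := fun a b => 'D_a ('D_b K) y) u v w
  (fun a b => derive_swap_mx y b a sP) (fun a b => derive_swap_mx y b a sK)).
Qed.

End ChernClosed.

(** * A map from the cube onto the sphere that crushes the boundary *)

Section Collapse.
Context {R : realType}.
Implicit Types (y v : 'rV[R]_6).

(** A function that is positive inside the cube and vanishes on its boundary; squaring
    it makes its derivative vanish there too. *)
Definition bump_root y : R := \prod_(i < 6) (y ord0 i * (1 - y ord0 i)).
Definition bumpf y : R := bump_root y * bump_root y.
Definition offset (i : 'I_6) y : R := y ord0 i - 2^-1.
Definition collapse_den y : R := bumpf y * bumpf y + \sum_(i < 6) offset i y * offset i y.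

(** The inverse stereographic projection of [offset / bumpf], an expansion of the open
    cube onto R^6 along the rays from its centre. In this form, without the division
    by [bumpf], it makes sense on the boundary of the cube, which is sent to the
    pole. *)
Definition collapse y : 'rV[R]_7 :=
  \row_k if unlift ord0 k is Some i then bumpf y * (2 * offset i y / collapse_den y)
         else 1 - bumpf y * (2 * bumpf y / collapse_den y).

Lemma collapse0 y : collapse y ord0 ord0 = 1 - bumpf y * (2 * bumpf y / collapse_den y).
Proof. by rewrite mxE unlift_none. Qed.

Lemma collapseS y i : collapse y ord0 (lift ord0 i) = bumpf y * (2 * offset i y / collapse_den y).
Proof. by rewrite mxE liftK. Qed.

(** The second summand vanishes at the centre of the cube only, and the first one does
    not vanish there. *)
Lemma collapse_den_gt0 y : 0 < collapse_den y.
Proof.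
have sq_ge0 (x : R) : 0 <= x * x by rewrite -expr2 sqr_ge0.
have s0 : 0 <= \sum_(i < 6) offset i y * offset i y by apply: sumr_ge0.
rewrite lt_def addr_ge0 // andbT /collapse_den paddr_eq0 //; apply/negP => /andP[u0 w0].
have w i : offset i y = 0.
  have := psumr_eq0P (fun i _ => sq_ge0 (offset i y)) (eqP w0).
  by move=> /(_ i isT)/eqP; rewrite mulf_eq0 orbb => /eqP.
move: u0; rewrite !mulf_eq0 !orbb /bump_root prodf_seq_eq0 => /hasP[i _ /=].
have := w i; rewrite /offset => wi; have -> : y ord0 i = 2^-1 by lra.
by rewrite mulf_eq0 => /orP[] /eqP; lra.
Qed.

Lemma collapse_den_neq0 y : collapse_den y != 0.
Proof. by rewrite lt0r_neq0 ?collapse_den_gt0. Qed.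

Lemma collapse_dot y : dot (collapse y) (collapse y) = 1.
Proof.
rewrite /dot big_ord_recl collapse0; under eq_bigr do rewrite collapseS.
set u := bumpf y; set d := collapse_den y.
have -> : \sum_(i < 6) u * (2 * offset i y / d) * (u * (2 * offset i y / d)) =
    4 * u ^+ 2 / d ^+ 2 * \sum_(i < 6) offset i y * offset i y.
  by rewrite mulr_sumr; apply: eq_bigr => i _; field; exact: collapse_den_neq0.
have -> : \sum_(i < 6) offset i y * offset i y = d - u * u by rewrite /d /collapse_den addrC addKr.
by field; exact: collapse_den_neq0.
Qed.

Definition collapse_pt y : sphere6 R := exist _ (collapse y) (introT eqP (collapse_dot y)).

Let oT := @openT 'rV[R]_6.

Lemma smooth_entry (i : 'I_6) : smooth_on setT (fun y => y ord0 i).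
Proof. exact: ((smooth_on_mxP oT _).1 (smooth_on_id oT)). Qed.

Lemma smooth_factor (i : 'I_6) : smooth_on setT (fun y => y ord0 i * (1 - y ord0 i)).
Proof.
have se := smooth_entry i.
apply: (smooth_onM oT se); apply: (smooth_onD oT); first exact: smooth_on_cst oT _ _.
exact: (smooth_onN oT se).
Qed.

Lemma smooth_root : smooth_on setT bump_root.
Proof. by apply: (smooth_on_prod oT) => i; exact: smooth_factor. Qed.

Lemma smooth_bumpf : smooth_on setT bumpf.
Proof. exact: (smooth_onM oT smooth_root smooth_root). Qed.

Lemma smooth_offset i : smooth_on setT (offset i).
Proof. by apply: (smooth_onD oT (smooth_entry i)); exact: smooth_on_cst oT _ _. Qed.

Lemma smooth_collapse_den : smooth_on setT collapse_den.
Proof.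
apply: (smooth_onD oT); first exact: (smooth_onM oT smooth_bumpf smooth_bumpf).
by apply: (smooth_on_sum oT) => i; exact: (smooth_onM oT (smooth_offset i) (smooth_offset i)).
Qed.

Lemma smooth_quotient (f : 'rV[R]_6 -> R) :
  smooth_on setT f -> smooth_on setT (fun y => 2 * f y / collapse_den y).
Proof.
move=> sf; apply: (smooth_onM oT).
  by apply: (smooth_onM oT) => //; exact: smooth_on_cst oT _ _.
by apply: (smooth_onV oT _ smooth_collapse_den) => y _; exact: collapse_den_neq0.
Qed.

Lemma smooth_collapse : smooth_on setT collapse.
Proof.
apply/(smooth_on_mxP oT) => i0 k; rewrite (ord1 i0).
case: (unliftP ord0 k) => [i ->|->].
  apply: (smooth_on_ext oT (fun y _ => esym (collapseS y i))).
  exact: (smooth_onM oT smooth_bumpf (smooth_quotient (smooth_offset i))).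
apply: (smooth_on_ext oT (fun y _ => esym (collapse0 y))).
apply: (smooth_onD oT); first exact: smooth_on_cst oT _ _.
exact: (smooth_onN oT (smooth_onM oT smooth_bumpf (smooth_quotient smooth_bumpf))).
Qed.

Lemma derive_bumpf v y : 'D_v bumpf y = 2 * (bump_root y * 'D_v bump_root y).
Proof.
have D := smooth_is_derive v smooth_root (I : setT y).
rewrite (@derive_val _ _ _ _ _ _ _ (is_derive_mul D D)) -/(bump_root y); ring.
Qed.

(** Each coordinate of [collapse] is a constant plus a multiple of [bumpf], which
    vanishes to second order on the boundary. *)
Lemma derive_collapse_boundary v y k :
  y ord0 k = 0 \/ y ord0 k = 1 -> 'D_v collapse y = 0.
Proof.
move=> yk; have m0 : bump_root y = 0.
  by apply/eqP; rewrite prodf_seq_eq0; apply/hasP; exists k; rewrite ?mem_index_enum //=;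
    case: yk => ->; rewrite ?mul0r // subrr mulr0.
have u0 : bumpf y = 0 by rewrite /bumpf m0 mul0r.
have du0 : 'D_v bumpf y = 0 by rewrite derive_bumpf m0 mul0r mulr0.
have prod0 (g : 'rV[R]_6 -> R) : smooth_on setT g ->
    is_derive y v (fun y => bumpf y * g y) 0.
  move=> sg; have := is_derive_mul (smooth_is_derive v smooth_bumpf (I : setT y))
    (smooth_is_derive v sg (I : setT y)).
  by rewrite du0 u0 !mul0r addr0.
apply: derive_val; apply: is_derive_mx => i0 j; rewrite (ord1 i0) mxE.
case: (unliftP ord0 j) => [i ->|->].
  rewrite (_ : (fun y => _) = fun y => bumpf y * (2 * offset i y / collapse_den y)); last first.
    by apply/funext => z; exact: collapseS.
  exact: prod0 (smooth_quotient (smooth_offset i)).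
rewrite (_ : (fun y => _) = fun y => 1 - bumpf y * (2 * bumpf y / collapse_den y)); last first.
  by apply/funext => z; exact: collapse0.
apply: is_derive_eq (is_derive_sub (is_derive_cst (1 : R) y v)
  (prod0 _ (smooth_quotient smooth_bumpf))) _.
by rewrite subr0.
Qed.

Lemma derive_offset i v y : 'D_v (offset i) y = v ord0 i.
Proof.
have D := smooth_is_derive v (smooth_entry i) (I : setT y).
have := is_derive_sub D (is_derive_cst (2^-1 : R) y v).
by move=> /(@derive_val _ _ _ _ _ _ _); rewrite subr0 derive_coord => <-.
Qed.

(** Along a ray from the centre, each factor y (1 - y) decreases. *)
Lemma derive_bumpf_radial y : (forall i, 0 < y ord0 i < 1) ->
  'D_(\row_i offset i y) bumpf y <= 0.
Proof.
move=> yin; set w := \row_i _.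
have [pos neg] : 0 <= bump_root y /\ 'D_w bump_root y <= 0.
  rewrite /bump_root; elim: (index_enum _) => [|i r [IH1 IH2]].
    rewrite big_nil ler01; split=> //.
    rewrite (_ : (fun y => _) = cst 1) ?derive_cst //.
    by apply/funext => z; rewrite big_nil.
  have /andP[y0 y1] := yin i.
  have f0 : 0 <= y ord0 i * (1 - y ord0 i) by rewrite mulr_ge0 ?subr_ge0 // ltW.
  have De := smooth_is_derive w (smooth_entry i) (I : setT y).
  have Df := is_derive_mul De (is_derive_sub (is_derive_cst (1 : R) y w) De).
  have sr : smooth_on setT (fun y => \prod_(j <- r) (y ord0 j * (1 - y ord0 j))).
    by apply: (smooth_on_prod oT) => j; exact: smooth_factor.
  have Dr := smooth_is_derive w sr (I : setT y).
  rewrite big_cons; split; first by rewrite mulr_ge0.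
  rewrite (_ : (fun y => _) = fun y => (y ord0 i * (1 - y ord0 i)) *
    \prod_(j <- r) (y ord0 j * (1 - y ord0 j))); last by apply/funext => z; rewrite big_cons.
  rewrite (@derive_val _ _ _ _ _ _ _ (is_derive_mul Df Dr)) /= derive_coord mxE /offset.
  set P := \prod_(j <- r) _ in IH1 *; set D := 'D_w _ y in IH2 *.
  have H1 : y ord0 i * (1 - y ord0 i) * D <= 0 by rewrite mulr_ge0_le0.
  have H2 : 0 <= (y ord0 i - 2^-1) ^+ 2 * P by rewrite mulr_ge0 ?sqr_ge0.
  by rewrite /cst sub0r; nra.
rewrite derive_bumpf mulr_ge0_le0 // mulr_ge0_le0 //.
Qed.

Lemma bumpf_gt0 y : (forall i, 0 < y ord0 i < 1) -> 0 < bumpf y.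
Proof.
move=> yin; have r0 : 0 < bump_root y.
  by apply: prodr_gt0 => i _; have /andP[y0 y1] := yin i; rewrite mulr_gt0 ?subr_gt0.
exact: mulr_gt0.
Qed.

(** Stereographic projection recovers [offset / bumpf] from [collapse], and this ratio
    is an immersion: its derivative could only vanish in a radial direction, where
    [bumpf] would have to increase, against [derive_bumpf_radial]. *)
Lemma collapse_immersion y v : (forall i, 0 < y ord0 i < 1) ->
  'D_v collapse y = 0 -> v = 0.
Proof.
move=> yin dp0; have u_gt0 := bumpf_gt0 yin; have u0 := lt0r_neq0 u_gt0.
have dE k : is_derive y v (fun y => collapse y ord0 k) 0.
  have := smooth_is_derive v smooth_collapse (I : setT y).
  by rewrite dp0 => D; have := is_derive_entry ord0 k D; rewrite mxE.
have Du := smooth_is_derive v smooth_bumpf (I : setT y).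
have Dw i := smooth_is_derive v (smooth_offset i) (I : setT y).
(* Stereographic projection, with the denominators cleared. *)
have rel i z : collapse z ord0 (lift ord0 i) * bumpf z =
    (1 - collapse z ord0 ord0) * offset i z.
  by rewrite collapse0 collapseS; field; exact: collapse_den_neq0.
have key i : offset i y * 'D_v bumpf y = bumpf y * v ord0 i.
  have := is_derive_mul (dE (lift ord0 i)) Du.
  have := is_derive_mul (is_derive_sub (is_derive_cst (1 : R) y v) (dE ord0)) (Dw i).
  move=> /(@derive_val _ _ _ _ _ _ _) E1 /(@derive_val _ _ _ _ _ _ _).
  rewrite (_ : (fun y => collapse y ord0 (lift ord0 i) * bumpf y) =
    fun y => (1 - collapse y ord0 ord0) * offset i y); last by apply/funext => z; exact: rel.
  rewrite E1 derive_offset !mul0r subrr mul0r !add0r collapse0 collapseS.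
  set d := collapse_den y; set D := 'D_v bumpf y => E; have d0 : d != 0 := collapse_den_neq0 y.
  have c0 : 2 * bumpf y / d != 0
    by apply: mulf_neq0; [apply: mulf_neq0 => //; rewrite pnatr_eq0|rewrite invr_neq0].
  apply: (mulfI c0).
  transitivity (bumpf y * (2 * offset i y / d) * D); first by ring.
  by rewrite -E /cst; ring.
set w : 'rV[R]_6 := \row_i offset i y.
set l := 'D_v bumpf y / bumpf y.
have vE : v = l *: w.
  by apply/rowP => i; rewrite !mxE /l mulrAC [_ * offset _ _]mulrC key mulrC mulKf.
have lE : l * bumpf y = l * 'D_w bumpf y.
  rewrite {1}/l divfK // vE !deriveE; try exact: (smooth_diff y smooth_bumpf).
  by rewrite linearZ.
have [l0|l0] := eqVneq l 0; first by rewrite vE l0 scale0r.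
have := derive_bumpf_radial yin; rewrite -/w -(mulfI l0 lE).
by rewrite leNgt u_gt0.
Qed.

End Collapse.

(** * The Euclidean product and the radial retraction *)

Section Dot.
Context {R : realType} {n : nat}.
Implicit Types u v w : 'rV[R]_n.

Lemma dotE u v : dot u v = (u *m v^T) ord0 ord0.
Proof. by rewrite /dot mxE; apply: eq_bigr => i _; rewrite mxE. Qed.

Lemma dot_scalar u v : u *m v^T = (dot u v)%:M.
Proof. by rewrite dotE; exact: mx11_scalar. Qed.

Lemma dotC u v : dot u v = dot v u.
Proof. by apply: eq_bigr => i _; rewrite mulrC. Qed.

Lemma dotDl u v w : dot (u + v) w = dot u w + dot v w.
Proof. by rewrite !dotE mulmxDl mxE. Qed.

Lemma dotNl u w : dot (- u) w = - dot u w.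
Proof. by rewrite !dotE mulNmx mxE. Qed.

Lemma dotBl u v w : dot (u - v) w = dot u w - dot v w.
Proof. by rewrite dotDl dotNl. Qed.

Lemma dotZl a u w : dot (a *: u) w = a * dot u w.
Proof. by rewrite !dotE -scalemxAl mxE. Qed.

Lemma dot_eq0 u : (forall c, dot u c = 0) -> u = 0.
Proof.
move=> H; apply/rowP => i; rewrite mxE -(H (delta_mx ord0 i)) /dot (bigD1 i) //=.
rewrite big1 => [|j ji]; first by rewrite mxE !eqxx mulr1 addr0.
by rewrite mxE (negPf ji) andbF mulr0.
Qed.

Lemma dot_ge0 u : 0 <= dot u u.
Proof. by apply: sumr_ge0 => i _; rewrite -expr2 sqr_ge0. Qed.

Lemma enorm_sqr u : enorm u ^+ 2 = dot u u.
Proof. by rewrite /enorm sqr_sqrtr ?dot_ge0. Qed.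

Lemma dot_self_eq0 u : dot u u = 0 -> u = 0.
Proof.
move=> H; apply/rowP => i; rewrite mxE; apply/eqP; rewrite -sqrf_eq0 expr2.
by apply/eqP; apply: (psumr_eq0P _ H) => // j _; rewrite -expr2 sqr_ge0.
Qed.

End Dot.

Section Retraction.
Context {R : realType}.
Implicit Types (x : sphere6 R) (v y : 'rV[R]_7).

Lemma sphere_dot x : dot (val x) (val x) = 1.
Proof. exact: eqP (valP x). Qed.

Definition radial y : 'rV[R]_7 := (enorm y)^-1 *: y.

Lemma enorm_sphere x : enorm (val x) = 1.
Proof. by rewrite /enorm sphere_dot sqrtr1. Qed.

Lemma radial_sphere x : radial (val x) = val x.
Proof. by rewrite /radial enorm_sphere invr1 scale1r. Qed.

Lemma smooth_dot_self : smooth_on setT (fun y : 'rV[R]_7 => dot y y).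
Proof.
have oT := @openT 'rV[R]_7; apply: (smooth_on_sum oT) => i.
have se : smooth_on setT (fun y : 'rV[R]_7 => y ord0 i).
  exact: ((smooth_on_mxP oT _).1 (smooth_on_id oT)).
exact: (smooth_onM oT se se).
Qed.

Lemma derive_dot_self y v : 'D_v (fun y : 'rV[R]_7 => dot y y) y = 2 * dot y v.
Proof.
have oT := @openT 'rV[R]_7.
have De i := smooth_is_derive v ((smooth_on_mxP oT _).1 (smooth_on_id oT) ord0 i) (I : setT y).
rewrite (@derive_val _ _ _ _ _ _ _ (is_derive_bigsum (fun i => is_derive_mul (De i) (De i)))).
by rewrite mulr_sumr; apply: eq_bigr => i _; rewrite derive_coord; ring.
Qed.

Lemma differentiable_enorm x : differentiable (@enorm R 7) (val x).
Proof.
apply: (@differentiable_comp _ _ _ _ (fun y => dot y y) Num.sqrt).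
  exact: (smooth_diff _ smooth_dot_self).
apply/derivable1_diffP; rewrite sphere_dot.
by have [] := is_derive1_sqrt (ltr01 : 0 < (1 : R)).
Qed.

Lemma derive_enorm_tangent x v : tangent x v -> 'D_v (@enorm R 7) (val x) = 0.
Proof.
move=> tv; rewrite deriveE; last exact: differentiable_enorm.
have dq := smooth_diff (val x) smooth_dot_self.
have ds : differentiable (Num.sqrt : R -> R) (dot (val x) (val x)).
  apply/derivable1_diffP; rewrite sphere_dot.
  by have [] := is_derive1_sqrt (ltr01 : 0 < (1 : R)).
rewrite (_ : @enorm R 7 = Num.sqrt \o (fun y => dot y y)) // diff_comp //=.
by rewrite -[X in 'd _ _ X]deriveE // derive_dot_self tv mulr0 linear0.
Qed.

Lemma differentiable_radial x : differentiable radial (val x).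
Proof.
apply/differentiable_mxP => i j; rewrite (ord1 i).
rewrite (_ : (fun y => _) = fun y => (enorm y)^-1 * y ord0 j); last first.
  by apply/funext => y; rewrite mxE.
apply: differentiableM; last exact: differentiable_coord.
by apply: differentiableV; [exact: differentiable_enorm|rewrite enorm_sphere oner_eq0].
Qed.

Lemma derive_radial x v : tangent x v -> 'D_v radial (val x) = v.
Proof.
move=> tv; apply/rowP => j; rewrite derive_entry; last exact: differentiable_radial.
rewrite (_ : (fun y => _) = fun y => (enorm y)^-1 * y ord0 j); last first.
  by apply/funext => y; rewrite mxE.
have De : is_derive (val x) v (@enorm R 7) 0.
  rewrite -(derive_enorm_tangent tv); apply/derivableP/diff_derivable.
  exact: differentiable_enorm.
have e0 : enorm (val x) != 0 by rewrite enorm_sphere oner_eq0.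
have Di : is_derive (val x) v (fun y => (enorm y)^-1) 0.
  have [de ve] := De; apply: DeriveDef; first exact: derivableV.
  by rewrite deriveV // ve scaler0.
have Dj : is_derive (val x) v (fun y : 'rV[R]_7 => y ord0 j) (v ord0 j).
  rewrite -(derive_coord (val x) v ord0 j); apply/derivableP/diff_derivable.
  exact: differentiable_coord.
rewrite (@derive_val _ _ _ _ _ _ _ (is_derive_mul Di Dj)).
by rewrite mul0r add0r enorm_sphere invr1 mul1r.
Qed.

Lemma dot_radial y : y != 0 -> dot (radial y) (radial y) == 1.
Proof.
move=> y0; have d0 : dot y y != 0 by apply: contraNneq y0 => /dot_self_eq0 ->.
rewrite /radial dotZl dotC dotZl mulrA -invfM -expr2 enorm_sqr.
by rewrite mulVf.
Qed.

(** The extension of [f] that is constant along rays, used to define [dS], can be traded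
    for any local extension [g] when the direction is tangent, because [radial] is
    differentiable and its derivative fixes tangent vectors. *)
Lemma dS_local (W : normedModType R) (f : sphere6 R -> W) x v (U : set 'rV[R]_7)
    (g : 'rV[R]_7 -> W) :
  open U -> U (val x) -> (forall y : sphere6 R, U (val y) -> f y = g (val y)) ->
  differentiable g (val x) -> tangent x v -> dS f x v = 'D_v g (val x).
Proof.
move=> oU Ux fg dg tv; rewrite /dS.
have cr : {for val x, continuous radial}.
  exact: differentiable_continuous (differentiable_radial x).
have nU : \forall y \near val x, U (radial y).
  by apply: cr; rewrite radial_sphere; exact: open_nbhs_nbhs.
have n0 : \forall y \near val x, y != 0.
  have x0 : val x != 0.
    apply/eqP => xE; have := sphere_dot x; rewrite xE /dot big1 => [/eqP|i _].
      by rewrite eq_sym oner_eq0.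
    by rewrite mxE mul0r.
  exact: (@cvgr_neq0 _ _ _ (nbhs (val x)) _ id (val x) cvg_id x0).
have E : \forall y \near val x, f (insubd x (radial y)) = (g \o radial) y.
  apply: filterS2 nU n0 => y Uy y0.
  have vE : val (insubd x (radial y)) = radial y.
    exact: (insubdK x (dot_radial y0)).
  by rewrite fg ?vE.
rewrite (near_eq_derive v E) derive_comp_row ?radial_sphere ?derive_radial //.
exact: differentiable_radial.
Qed.
End Retraction.

(** * Differentiation on the sphere *)

Section SphereCalculus.
Context {R : realType}.
Implicit Types (x y : sphere6 R) (v w c : 'rV[R]_7).

Lemma smooth_restriction (W : normedModType R) (g : 'rV[R]_7 -> W) :
  smooth_on setT g -> smooth (fun y : sphere6 R => g (val y)).
Proof. by move=> sg x; exists setT, g; split => //; exact: openT. Qed.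

Lemma dS_restriction (W : normedModType R) (g : 'rV[R]_7 -> W) x v :
  smooth_on setT g -> tangent x v -> dS (fun y => g (val y)) x v = 'D_v g (val x).
Proof.
move=> sg tv; apply: (dS_local (U := setT)) => //; first exact: openT.
exact: smooth_diff.
Qed.

Lemma smooth_common (W W' : normedModType R) (F : sphere6 R -> W) (G : sphere6 R -> W') x :
  smooth F -> smooth G -> exists U f g, [/\ open U, U (val x),
    smooth_on U f, smooth_on U g &
    forall y, U (val y) -> F y = f (val y) /\ G y = g (val y)].
Proof.
move=> /(_ x)[U [f [oU Ux sf Ff]]] /(_ x)[U' [g [oU' Ux' sg Gg]]].
exists (U `&` U'), f, g; split => //.
- exact: openI.
- by apply: smooth_onS sf => z [].
- by apply: smooth_onS sg => z [].
- by move=> y [Uy Uy']; split; [exact: Ff|exact: Gg].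
Qed.

Lemma smooth_mulmx (a b k : nat) (F : sphere6 R -> 'M[R]_(a, b)) (G : sphere6 R -> 'M[R]_(b, k)) :
  smooth F -> smooth G -> smooth (fun y => F y *m G y).
Proof.
move=> sF sG x; have [U [f [g [oU Ux sf sg FG]]]] := smooth_common x sF sG.
exists U, (fun z => f z *m g z); split => //; first exact: smooth_on_mulmx.
by move=> y /FG [-> ->].
Qed.

Lemma dS_mulmx (a b k : nat) (F : sphere6 R -> 'M[R]_(a, b)) (G : sphere6 R -> 'M[R]_(b, k)) x v :
  smooth F -> smooth G -> tangent x v ->
  dS (fun y => F y *m G y) x v = dS F x v *m G x + F x *m dS G x v.
Proof.
move=> sF sG tv; have [U [f [g [oU Ux sf sg FG]]]] := smooth_common x sF sG.
have [-> ->] := FG x Ux.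
rewrite (dS_local oU Ux _ (smooth_on_diff sf Ux) tv); last by move=> y /FG [].
rewrite (dS_local oU Ux _ (smooth_on_diff sg Ux) tv); last by move=> y /FG [].
have D := is_derive_mulmx (smooth_is_derive v sf Ux) (smooth_is_derive v sg Ux).
rewrite -(@derive_val _ _ _ _ _ _ _ D).
apply: (dS_local oU Ux) => //; first by move=> y /FG [-> ->].
exact: smooth_on_diff (smooth_on_mulmx oU sf sg) Ux.
Qed.

Lemma smooth_dot (n : nat) (Y Z : sphere6 R -> 'rV[R]_n) :
  smooth Y -> smooth Z -> smooth (fun y => dot (Y y) (Z y)).
Proof.
move=> sY sZ x; have [U [f [g [oU Ux sf sg FG]]]] := smooth_common x sY sZ.
exists U, (fun z => dot (f z) (g z)); split => //; last by move=> y /FG [-> ->].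
apply: (smooth_on_sum oU) => i.
by apply: (smooth_onM oU); exact: (smooth_on_mxP oU _).1.
Qed.

Lemma dS_dot (n : nat) (Y Z : sphere6 R -> 'rV[R]_n) x v :
  smooth Y -> smooth Z -> tangent x v ->
  dS (fun y => dot (Y y) (Z y)) x v = dot (dS Y x v) (Z x) + dot (Y x) (dS Z x v).
Proof.
move=> sY sZ tv; have [U [f [g [oU Ux sf sg FG]]]] := smooth_common x sY sZ.
have [-> ->] := FG x Ux.
rewrite (dS_local oU Ux _ (smooth_on_diff sf Ux) tv); last by move=> y /FG [].
rewrite (dS_local oU Ux _ (smooth_on_diff sg Ux) tv); last by move=> y /FG [].
have Df := smooth_is_derive v sf Ux; have Dg := smooth_is_derive v sg Ux.
have D := is_derive_bigsum (fun i => is_derive_mul (is_derive_entry ord0 i Df)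
  (is_derive_entry ord0 i Dg)).
rewrite /dot -big_split -(@derive_val _ _ _ _ _ _ _ D).
apply: (dS_local oU Ux) => //; first by move=> y /FG [-> ->].
apply: (smooth_on_diff (U := U)) => //; apply: (smooth_on_sum oU) => i.
by apply: (smooth_onM oU); exact: (smooth_on_mxP oU _).1.
Qed.

Lemma dS_linear (W : normedModType R) (F : sphere6 R -> W) x (a : R) v w :
  smooth F -> tangent x v -> tangent x w ->
  dS F x (a *: v + w) = a *: dS F x v + dS F x w.
Proof.
move=> sF tv tw; have [U [f [oU Ux sf Ff]]] := sF x.
have tvw : tangent x (a *: v + w).
  by rewrite /tangent dotC dotDl dotZl !(dotC _ (val x)) tv tw mulr0 addr0.
rewrite !(dS_local oU Ux Ff (smooth_on_diff sf Ux)) //.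
by rewrite !deriveE; try exact: smooth_on_diff sf Ux; rewrite linearP.
Qed.

Lemma dS_const (W : normedModType R) (c : W) x v : tangent x v -> dS (fun=> c) x v = 0.
Proof.
move=> tv; rewrite (dS_local (g := cst c) openT I _ (differentiable_cst c (val x)) tv) //.
exact: derive_cst.
Qed.

Lemma smooth_const (W : normedModType R) (c : W) : smooth (fun _ : sphere6 R => c).
Proof. by apply: (smooth_restriction (g := fun=> c)); apply: smooth_on_cst; exact: openT. Qed.

Lemma dS_val x v : tangent x v -> dS (fun y : sphere6 R => val y) x v = v.
Proof.
move=> tv; rewrite (dS_restriction (g := id)) ?derive_id //.
exact: smooth_on_id openT.
Qed.

Lemma smooth_val : smooth (fun y : sphere6 R => val y).
Proof. by apply: (smooth_restriction (g := id)); exact: smooth_on_id openT. Qed.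

Definition tproj x : 'M[R]_7 := 1%:M - (val x)^T *m val x.

Lemma val_tproj x : val x *m tproj x = 0.
Proof. by rewrite mulmxBr mulmx1 mulmxA dot_scalar sphere_dot mul1mx subrr. Qed.

Lemma tproj_trmx x : (tproj x)^T = tproj x.
Proof. by rewrite /tproj linearB /= trmx1 trmx_mul trmxK. Qed.

Lemma dot_mulmxr (u v : 'rV[R]_7) (A : 'M[R]_7) : dot (u *m A) v = dot u (v *m A^T).
Proof. by rewrite !dotE trmx_mul trmxK mulmxA. Qed.

Lemma tangent_tproj x v : tangent x (v *m tproj x).
Proof. by rewrite /tangent dotC dot_mulmxr tproj_trmx val_tproj dotE trmx0 mulmx0 mxE. Qed.

Lemma tproj_tangent x v : tangent x v -> v *m tproj x = v.
Proof.
by move=> tv; rewrite mulmxBr mulmx1 mulmxA dot_scalar dotC tv raddf0 mul0mx subr0.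
Qed.

Lemma dot_tproj x u w : tangent x w -> dot (u *m tproj x) w = dot u w.
Proof. by move=> tw; rewrite dot_mulmxr tproj_trmx tproj_tangent. Qed.

Lemma tproj_idem x : tproj x *m tproj x = tproj x.
Proof.
by apply/row_matrixP => i; rewrite row_mul !rowE tproj_tangent //; exact: tangent_tproj.
Qed.

Lemma smooth_tproj : smooth tproj.
Proof.
apply: (smooth_restriction (g := fun z : 'rV[R]_7 => 1%:M - z^T *m z)).
have oT := @openT 'rV[R]_7; have si := smooth_on_id oT.
apply: (smooth_on_ext oT (f := fun z : 'rV[R]_7 => 1%:M + (-1 : R) *: (z^T *m z))).
  by move=> z _; rewrite scaleN1r.
apply: (smooth_onD oT); first exact: smooth_on_cst oT _ _.
apply: (smooth_on_scale oT); first exact: smooth_on_cst oT _ _.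
exact: (smooth_on_mulmx oT (smooth_on_trmx oT si) si).
Qed.

Definition projected_field w : sphere6 R -> 'rV[R]_7 := fun y => w *m tproj y.

Lemma projected_field_vector_field w : vector_field (projected_field w).
Proof.
split; last by move=> x; exact: tangent_tproj.
apply: smooth_mulmx; [exact: smooth_const|exact: smooth_tproj].
Qed.

End SphereCalculus.

(** * Uniqueness of the Levi-Civita connection *)

(** A trilinear form that is skew in the last two arguments and symmetric in the first
    two changes sign under cyclic permutations, which have odd order. *)
Lemma skew_sym_braid (R : realType) (T : Type) (P : T -> Prop) (q : T -> T -> T -> R) :
  (forall U V W, P U -> P V -> P W -> q U V W = - q U W V) ->
  (forall U V W, P U -> P V -> P W -> q U V W = q V U W) ->
  forall U V W, P U -> P V -> P W -> q U V W = 0.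
Proof.
move=> skew sym U V W pU pV pW.
have flip A B C : P A -> P B -> P C -> q A B C = - q C A B.
  by move=> pA pB pC; rewrite skew // sym.
have := flip U V W pU pV pW; rewrite (flip W U V) // (flip V W U) // opprK; lra.
Qed.

Section LeviCivita.
Context {R : realType}.
Context (nabla : sphere6 R -> 'rV[R]_7 -> (sphere6 R -> 'rV[R]_7) -> 'rV[R]_7).
Context (LC : levi_civita nabla).
Implicit Types (x y : sphere6 R) (X Y Z : sphere6 R -> 'rV[R]_7).

Let AC := levi_civita_connection LC.

Let connection_gap x X Y := nabla x (X x) Y - dS Y x (X x) *m tproj x.

Lemma connection_gap_tangent x X Y : vector_field X -> vector_field Y -> tangent x (connection_gap x X Y).
Proof.
move=> [sX tX] vY; rewrite /tangent dotC dotBl !(dotC _ (val x)).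
by rewrite (connection_tangent AC) ?tX // (tangent_tproj x) subrr.
Qed.

Lemma connection_gap_skew x X Y Z : vector_field X -> vector_field Y -> vector_field Z ->
  dot (connection_gap x X Y) (Z x) = - dot (connection_gap x X Z) (Y x).
Proof.
move=> vX vY vZ; have [sX tX] := vX; have [sY tY] := vY; have [sZ tZ] := vZ.
have E := etrans (esym (dS_dot sY sZ (tX x))) (levi_civita_metric LC (tX x) vY vZ).
have D W W' : tangent x (W' x) -> dot (connection_gap x X W) (W' x) =
    dot (nabla x (X x) W) (W' x) - dot (dS W x (X x)) (W' x).
  by move=> tW; exact: etrans (dotBl _ _ _) (congr1 (fun r => _ - r) (dot_tproj _ tW)).
apply: etrans (D Y Z (tZ x)) (esym _); apply: etrans (congr1 -%R (D Z Y (tY x))) _.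
have balance (a b c d : R) : a + b = c + d -> c - a = - (d - b) by lra.
exact: esym (balance _ _ _ _ (etrans (congr1 (+%R _) (dotC _ _)) (etrans E (congr1 (+%R _) (dotC _ _))))).
Qed.

(** Both connections are torsion free. For [nabla] the condition is only tested on the
    restrictions of linear functions, for which the second derivatives of the test
    function along the vector fields are first derivatives of the fields. *)
Lemma connection_gap_sym x X Y : vector_field X -> vector_field Y ->
  connection_gap x X Y = connection_gap x Y X.
Proof.
move=> vX vY; have [sX tX] := vX; have [sY tY] := vY.
have tXY := connection_tangent AC (tX x) vY; have tYX := connection_tangent AC (tY x) vX.
have tD : tangent x (nabla x (X x) Y - nabla x (Y x) X).
  by rewrite /tangent dotC dotBl !(dotC _ (val x)) tXY tYX subrr.
have lin c y v : tangent y v -> dS (fun y : sphere6 R => dot c (val y)) y v = dot c v.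
  move=> tv; rewrite dS_dot ?dS_const ?dS_val //; last exact: smooth_val.
    by rewrite dotE mul0mx mxE add0r.
  exact: smooth_const.
have field c W v : vector_field W -> tangent x v ->
    dS (fun y => dS (fun y : sphere6 R => dot c (val y)) y (W y)) x v = dot c (dS W x v).
  move=> [sW tW] tv; rewrite (_ : (fun y => _) = fun y => dot c (W y)); last first.
    by apply/funext => y; exact: lin.
  rewrite dS_dot ?dS_const //; last exact: smooth_const.
  by rewrite dotE mul0mx mxE add0r.
have E : nabla x (X x) Y - nabla x (Y x) X = dS Y x (X x) - dS X x (Y x).
  apply/eqP; rewrite -subr_eq0; apply/eqP/dot_eq0 => c.
  have sc : smooth (fun y : sphere6 R => dot c (val y)).
    by apply: smooth_dot; [exact: smooth_const|exact: smooth_val].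
  have E := etrans (esym (lin c x _ tD)) (etrans (levi_civita_torsion_free LC x vX vY sc)
    (congr2 (fun a b => a - b) (field c Y _ vY (tX x)) (field c X _ vX (tY x)))).
  by rewrite dotBl dotC E [dot (_ - _) c]dotBl !(dotC _ c) subrr.
have EP : nabla x (X x) Y - nabla x (Y x) X =
    dS Y x (X x) *m tproj x - dS X x (Y x) *m tproj x.
  by rewrite -mulmxBl -E (tproj_tangent tD).
have cancel4 (a b s t : 'rV[R]_7) : a - b = s - t -> a - s = b - t.
  by move=> /rowP H; apply/rowP => i; have := H i; rewrite !mxE; lra.
exact: cancel4 EP.
Qed.

(** Uniqueness of the Levi-Civita connection, by [skew_sym_braid]; a tangent vector is
    extended to a vector field by projecting a constant one. *)
Lemma nablaE x v Y : tangent x v -> vector_field Y ->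
  nabla x v Y = dS Y x v *m tproj x.
Proof.
move=> tv vY; pose X := projected_field v; have vX : vector_field X := projected_field_vector_field v.
have Xx : X x = v by exact: tproj_tangent.
apply/eqP; rewrite -subr_eq0 -Xx -/(connection_gap x X Y); apply/eqP.
have tB := connection_gap_tangent x vX vY.
pose Z := projected_field (connection_gap x X Y); have vZ : vector_field Z := projected_field_vector_field _.
have Zx : Z x = connection_gap x X Y by exact: tproj_tangent.
apply: dot_self_eq0; rewrite -{2}Zx.
exact: (skew_sym_braid (fun U V W vU vV vW => connection_gap_skew x vU vV vW)
  (fun U V W vU vV _ => congr1 (fun B => dot B (W x)) (connection_gap_sym x vU vV)) vX vY vZ).
Qed.

End LeviCivita.

(** * The Chern form in terms of the covariant derivative *)

Section ChernSplit.
Context {R : realType} {n : nat}.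
Implicit Types (P K X Y N : 'M[R]_n).

(** The block decomposition of [X] and [Y] with respect to [P]: the off-diagonal blocks
    of [Y] are determined by those of [X], here the second fundamental form. *)
Lemma tangent_block P K X Y : complex_proj P K -> complex_proj_tangent P K X Y ->
  [/\ P *m X *m P = 0, P *m Y = P *m Y *m P + K *m X &
      Y *m P = P *m Y *m P + X *m K].
Proof.
move=> [PP KK PK KP] [XP YK XK YP]; split.
- have : P *m (X *m P + P *m X) = P *m X by rewrite XP.
  rewrite mulmxDr !mulmxA PP => /eqP.
  by rewrite -subr_eq0 addrK => /eqP.
- by rewrite -[in LHS]YP mulmxDr !mulmxA PK.
- by rewrite -[in LHS]XK mulmxDl -mulmxA KP addrC.
Qed.

Lemma complex_projl P K (Z : 'M[R]_n) : complex_proj P K ->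
  (P *m (P *m Z) = P *m Z) * (P *m (K *m Z) = K *m Z) *
  (K *m (P *m Z) = K *m Z) * (K *m (K *m Z) = - (P *m Z)).
Proof. by move=> [PP KK PK KP]; rewrite !mulmxA PP KK PK KP mulNmx. Qed.

Lemma anticommute_block P K X Y : complex_proj P K -> complex_proj_tangent P K X Y ->
  let N := P *m Y *m P in N *m K = - (K *m N).
Proof.
move=> PK T N; have [PXP _ _] := tangent_block PK T.
have El Z := complex_projl Z PK.
move: (PK) T => [_ _ PKe KPe] [_ YK _ _].
apply/eqP; rewrite -addr_eq0 /N -!mulmxA PKe El.
have := congr1 (fun Z => P *m (Z *m P)) YK.
rewrite mulmxDl mulmxDr -!mulmxA KPe El => ->.
by rewrite mulNmx mulmxN mulmxA PXP oppr0.
Qed.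

(** The Gauss equation: each of the four terms of [chern_alg] contributes one copy of
    the trace of [K [X, X']], which comes from the off-diagonal blocks, and the second
    one contributes in addition the blocks of [Y] and [Y'] inside the image of [P]. *)
Lemma chern_alg_split P K X Y X' Y' : complex_proj P K ->
  complex_proj_tangent P K X Y -> complex_proj_tangent P K X' Y' ->
  chern_alg P K X Y X' Y' =
    4 * trace_bracket K X X' - trace_bracket K (P *m Y *m P) (P *m Y' *m P).
Proof.
move=> HK T T'; have El Z := complex_projl Z HK; have [PP KK PK KP] := HK.
have PAAK A A' : \tr (P *m (A *m (A' *m K))) = \tr (K *m (A *m A')).
  by rewrite mxtrace_mulC -!mulmxA KP [RHS]mxtrace_mulC -!mulmxA.
have YY A B A' B' : complex_proj_tangent P K A B -> complex_proj_tangent P K A' B' ->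
    \tr (K *m (B *m B')) = \tr (K *m (P *m B *m P *m (P *m B' *m P))) - \tr (K *m (A *m A')).
  move=> TA TA'; have [a1 a2 a3] := tangent_block HK TA.
  have [b1 b2 b3] := tangent_block HK TA'.
  have -> : \tr (K *m (B *m B')) = \tr (K *m ((P *m B) *m (B' *m P))).
    rewrite -!mulmxA El [RHS]mxtrace_mulC -!mulmxA PK.
    by rewrite [LHS]mxtrace_mulC -!mulmxA.
  have z1 : P *m B *m P *m (A' *m K) = 0.
    have z : P *m (A' *m K) = 0 by rewrite -PK !mulmxA b1 mul0mx.
    by rewrite -!mulmxA z !mulmx0.
  have z2 : K *m A *m (P *m B' *m P) = 0.
    have z : K *m (A *m P) = 0 by rewrite -KP -!mulmxA [P *m _]mulmxA a1 mulmx0.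
    by rewrite !mulmxA -[K *m A *m P]mulmxA z !mul0mx.
  rewrite [in LHS]a2 [in LHS]b3 mulmxDl !mulmxDr z1 z2 !mulmx0 addr0 add0r mxtraceD; congr (_ + _).
  by rewrite -!mulmxA El raddfN /= PAAK.
have XY A B A' B' : complex_proj_tangent P K A B -> complex_proj_tangent P K A' B' ->
    \tr (P *m (A *m B')) = \tr (K *m (A *m A')).
  move=> TA TA'; have [a1 _ _] := tangent_block HK TA.
  have [_ _ b3] := tangent_block HK TA'.
  have -> : \tr (P *m (A *m B')) = \tr (P *m (A *m (B' *m P))).
    by rewrite mxtrace_mulC -!mulmxA [RHS]mxtrace_mulC -!mulmxA PP.
  by rewrite b3 !mulmxDr mxtraceD PAAK !mulmxA a1 !mul0mx mxtrace0 add0r.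
have YX A B A' B' : complex_proj_tangent P K A B -> complex_proj_tangent P K A' B' ->
    \tr (P *m (B' *m A)) = \tr (K *m (A' *m A)).
  move=> TA TA'; have [a1 _ _] := tangent_block HK TA.
  have [_ b2 _] := tangent_block HK TA'.
  rewrite mulmxA b2 mulmxDl mxtraceD -[in X in _ + X]mulmxA.
  have -> : \tr (P *m B' *m P *m A) = 0.
    rewrite -!mulmxA mxtrace_mulC -!mulmxA [P *m (A *m P)]mulmxA a1.
    by rewrite mulmx0 mxtrace0.
  by rewrite add0r.
rewrite /chern_alg /trace_bracket !mulmxBr !raddfB /=.
rewrite (YY _ _ _ _ T T') (YY _ _ _ _ T' T) (XY _ _ _ _ T T') (XY _ _ _ _ T' T).
rewrite (YX _ _ _ _ T T') (YX _ _ _ _ T' T).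
by ring.
Qed.

End ChernSplit.

(** * Almost complex structures on the sphere *)

Section AlmostComplex.
Context {R : realType}.
Context (J : sphere6 R -> 'M[R]_7) (acsJ : almost_complex_structure J).
Implicit Types (x y : sphere6 R) (v w : 'rV[R]_7).

Let sJ := acs_smooth acsJ.

Lemma acs_complex_proj x : complex_proj (tproj x) (J x).
Proof.
have [xJ tJ] := acs_end acsJ x.
have PJ : tproj x *m J x = J x by rewrite mulmxBl mul1mx -mulmxA xJ mulmx0 subr0.
have split_row (A B : 'M[R]_7) : tproj x *m A = A -> tproj x *m B = B ->
    (forall v, tangent x v -> v *m A = v *m B) -> A = B.
  move=> PA PB H; apply/row_matrixP => i; rewrite !rowE -PA -PB !mulmxA.
  exact: H (tangent_tproj x _).
split => //; first exact: tproj_idem.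
- apply: split_row; [by rewrite mulmxA PJ|by rewrite mulmxN tproj_idem|].
  move=> v tv; rewrite mulmxA (acs_square acsJ tv) mulmxN tproj_tangent //.
- apply: split_row; [by rewrite mulmxA PJ|exact: PJ|].
  by move=> v tv; rewrite mulmxA tproj_tangent //; exact: tJ.
Qed.

Lemma acs_tangent x v : tangent x v ->
  complex_proj_tangent (tproj x) (J x) (dS tproj x v) (dS J x v).
Proof.
move=> tv; have sP := @smooth_tproj R.
have rule (F G H : sphere6 R -> 'M[R]_7) : smooth F -> smooth G ->
    (forall y, F y *m G y = H y) -> dS F x v *m G x + F x *m dS G x v = dS H x v.
  move=> sF sG FGH; rewrite -(dS_mulmx sF sG tv); congr (dS _ x v).
  by apply/funext.
split.
- by apply: rule => // y; have [] := acs_complex_proj y.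
- rewrite (rule J J (fun y => (-1)%:M *m tproj y)) //; last first.
    by move=> y; have [_ -> _ _] := acs_complex_proj y; rewrite mul_scalar_mx scaleN1r.
  rewrite dS_mulmx //; last exact: smooth_const.
  by rewrite dS_const // mul0mx add0r mul_scalar_mx scaleN1r.
- by rewrite (rule tproj J J) // => y; have [] := acs_complex_proj y.
- by rewrite (rule J tproj J) // => y; have [] := acs_complex_proj y.
Qed.

Lemma acs_tangent_mul x v : tangent x v -> tangent x (v *m J x).
Proof. by have [_] := acs_end acsJ x; apply. Qed.

(** The covariant derivative of [J] in the direction [v]; see [nabla_endE]. *)
Definition cov_end x v : 'M[R]_7 := tproj x *m dS J x v *m tproj x.

Lemma nabla_acs nabla x v Y : levi_civita nabla -> tangent x v -> vector_field Y ->
  nabla x v (fun y => Y y *m J y) - nabla x v Y *m J x = Y x *m cov_end x v.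
Proof.
move=> LC tv vY; have [sY tY] := vY; have [PP _ PJ JP] := acs_complex_proj x.
have vYJ : vector_field (fun y => Y y *m J y).
  by split; [exact: smooth_mulmx|move=> y; exact: acs_tangent_mul].
rewrite (nablaE LC tv vYJ) (nablaE LC tv vY) (dS_mulmx sY sJ tv).
rewrite mulmxDl -!mulmxA PJ JP [X in X - _]addrC addrK.
by rewrite /cov_end !mulmxA (tproj_tangent (tY x)).
Qed.

Lemma cov_end_tangent x v : tangent_end x (cov_end x v).
Proof.
split=> [|w _]; first by rewrite /cov_end !mulmxA val_tproj !mul0mx.
by rewrite /cov_end mulmxA; exact: tangent_tproj.
Qed.

(** Uniqueness holds because the projections of constant fields take all tangent vectors
    as values. *)
Lemma nabla_endE nabla x v : levi_civita nabla -> tangent x v ->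
  nabla_end nabla J x v = cov_end x v.
Proof.
move=> LC tv; have cN := cov_end_tangent x v.
apply: xget_unique => [|A [[xA tA] HA]].
  by split => // Y vY; rewrite (nabla_acs LC tv vY).
apply/row_matrixP => i; rewrite !rowE; set w := delta_mx _ _.
have dec (B : 'M[R]_7) : val x *m B = 0 -> w *m B = projected_field w x *m B.
  move=> xB; rewrite /projected_field /tproj mulmxBr mulmx1 mulmxBl [X in _ - X *m _]mulmxA.
  by rewrite -[X in _ - X]mulmxA xB mulmx0 subr0.
have vw := projected_field_vector_field w.
by rewrite (dec _ xA) (dec _ cN.1) (HA _ vw) (nabla_acs LC tv vw).
Qed.

Lemma dS_tproj x v : tangent x v ->
  dS (@tproj R) x v = - (v^T *m val x + (val x)^T *m v).
Proof.
move=> tv; have oT := @openT 'rV[R]_7; have si := smooth_on_id oT.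
pose g (z : 'rV[R]_7) : 'M[R]_7 := 1%:M - z^T *m z.
have Di := is_derive_id (val x : 'rV[R]_7) v.
have D : is_derive (val x : 'rV[R]_7) v g (0 - (v^T *m val x + (val x)^T *m v)) :=
  is_derive_sub (is_derive_cst (1%:M : 'M[R]_7) (val x : 'rV[R]_7) v)
    (is_derive_mulmx (is_derive_trmx Di) Di).
have sg : smooth_on setT g.
  apply: (smooth_on_ext oT (f := fun z : 'rV[R]_7 => 1%:M + (-1 : R) *: (z^T *m z))).
    by move=> z _; rewrite scaleN1r.
  apply: (smooth_onD oT); first exact: smooth_on_cst oT _ _.
  apply: (smooth_on_scale oT); first exact: smooth_on_cst oT _ _.
  exact: (smooth_on_mulmx oT (smooth_on_trmx oT si) si).
rewrite (dS_restriction (g := g) sg tv) (@derive_val _ _ _ _ _ _ _ D) sub0r //.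
Qed.

Lemma mxtrace_row (u w : 'rV[R]_7) (A : 'M[R]_7) : \tr (A *m (u^T *m w)) = dot (w *m A) u.
Proof. by rewrite mulmxA mxtrace_mulC mulmxA dotE /mxtrace big_ord1. Qed.

(** The term of [chern_alg_split] that involves [tproj] is computed from [dS_tproj]. *)
Lemma chern_alg_tame x v : tangent x v ->
  let w := v *m J x in
  chern_alg (tproj x) (J x) (dS tproj x v) (dS J x v) (dS tproj x w) (dS J x w) =
  - 4 * (dot v v + dot w w) - trace_bracket (J x) (cov_end x v) (cov_end x w).
Proof.
move=> tv w; have tw : tangent x w := acs_tangent_mul tv.
have HJ := acs_complex_proj x; have [PP JJ PJ JP] := HJ.
apply: (@etrans _ _ (4 * trace_bracket (J x) (dS tproj x v) (dS tproj x w) -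
  trace_bracket (J x) (cov_end x v) (cov_end x w))).
  exact: chern_alg_split HJ (acs_tangent tv) (acs_tangent tw).
have xJ : val x *m J x = 0 by have [] := acs_end acsJ x.
have prod (a b : 'rV[R]_7) : tangent x a -> tangent x b ->
    \tr (J x *m (- (a^T *m val x + (val x)^T *m a) *m - (b^T *m val x + (val x)^T *m b))) =
    dot (b *m J x) a.
  move=> ta tb; rewrite mulNmx mulmxN opprK mulmxDl !mulmxDr.
  have -> : a^T *m val x *m (b^T *m val x) = 0.
    by rewrite -mulmxA [val x *m _]mulmxA dot_scalar tb raddf0 mul0mx mulmx0.
  have -> : a^T *m val x *m ((val x)^T *m b) = a^T *m b.
    by rewrite -mulmxA [val x *m _]mulmxA dot_scalar sphere_dot mul1mx.
  have Jx0 z : J x *m ((val x)^T *m z) = 0 :> 'M[R]_7.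
    by rewrite -JP mulmxA -[J x *m _ *m _]mulmxA -[tproj x]tproj_trmx -trmx_mul val_tproj
      trmx0 mulmx0 mul0mx.
  by rewrite mulmx0 add0r -[(val x)^T *m a *m _]mulmxA -[(val x)^T *m a *m _]mulmxA !Jx0 !addr0 mxtrace_row.
have trX : trace_bracket (J x) (dS tproj x v) (dS tproj x w) = - (dot v v + dot w w).
  rewrite (dS_tproj tv) (dS_tproj tw) /trace_bracket mulmxBr raddfB /= (prod _ _ tv tw) (prod _ _ tw tv).
  by rewrite -/w {1}/w -mulmxA JJ mulmxN (tproj_tangent tv) dotNl opprD.
rewrite trX mulrN mulNr; congr (_ - _).
Qed.

Lemma cov_end_anticommute x v : tangent x v ->
  cov_end x v *m J x = - (J x *m cov_end x v).
Proof. by move=> tv; exact: (anticommute_block (acs_complex_proj x) (acs_tangent tv)). Qed.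

Lemma cov_endZ x (a : R) v : tangent x v -> cov_end x (a *: v) = a *: cov_end x v.
Proof.
move=> tv; have t0 : tangent x 0 by rewrite /tangent dotE trmx0 mulmx0 mxE.
have := dS_linear a sJ tv t0; rewrite addr0 => E.
have z : dS J x 0 = 0 by rewrite /dS derive0.
by rewrite /cov_end E z addr0 -scalemxAr -scalemxAl.
Qed.

(** The matrix [(P + iJ) / 2] is a projection onto [T01], so that the trace of the
    restriction of an endomorphism [C] that commutes with [J] is the trace of
    [C (P + iJ) / 2]. *)
Lemma Im_trace_T01 x (C : 'M[R]_7) : C *m J x = J x *m C ->
  complex.Im (trace_T01 J x C) = 2^-1 * \tr (J x *m C).
Proof.
move=> CJ; have [PP JJ PJ JP] := acs_complex_proj x.
set Q := cmx (tproj x) (J x); set T := T01 J x; set c := complexify C.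
have cC : c = cmx C 0 by rewrite /cmx /complexify map_mx0 scaler0 addr0.
have cJ : complexify (J x) = cmx (J x) 0 by rewrite /cmx /complexify map_mx0 scaler0 addr0.
have CP : C *m tproj x = tproj x *m C.
  by apply: oppr_inj; rewrite -mulmxN -mulNmx -JJ mulmxA CJ -mulmxA CJ mulmxA.
have QC : Q *m c = c *m Q.
  by rewrite cC !cmx_mul !mulmx0 !mul0mx !subr0 addr0 add0r CJ CP.
have cP : complexify (tproj x) = 1%:M - (complexify (val x))^T *m complexify (val x).
  by rewrite /complexify map_mxB map_mx1 map_mxM map_trmx.
have Tx : T *m (complexify (val x))^T = 0.
  by apply/sub_kermxP; exact: capmxSl.
have TJ : T *m complexify (J x) = - 'i%C *: T.
  by apply/eigenspaceP; exact: capmxSr.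
have TQ : T *m Q = 2%:R *: T.
  rewrite /Q /cmx mulmxDr -scalemxAr TJ cP mulmxBr mulmx1 mulmxA Tx mul0mx subr0.
  by rewrite scalerA mulrN -expr2 sqr_i opprK scale1r -mulr2n scaler_nat.
have Jx : J x *m (val x)^T = 0.
  by rewrite -JP -mulmxA -[tproj x]tproj_trmx -trmx_mul val_tproj trmx0 mulmx0.
have Px : tproj x *m (val x)^T = 0.
  by rewrite -[tproj x]tproj_trmx -trmx_mul val_tproj trmx0.
have QT : (Q <= T)%MS.
  rewrite sub_capmx; apply/andP; split.
    apply/sub_kermxP; rewrite /complexify map_trmx -/(complexify _) /Q /cmx mulmxDl -scalemxAl.
    by rewrite /complexify -!map_mxM Px Jx !map_mx0 scaler0 addr0.
  apply/eigenspaceP; rewrite cJ cmx_mul !mulmx0 subr0 add0r PJ JJ.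
  rewrite /Q /cmx scalerDr scalerA mulNr -expr2 sqr_i opprK scale1r addrC.
  by rewrite /complexify map_mxN scalerN scaleNr.
have tr2 r (B : 'M[R[i]]_(r, 7)) : (B :=: T)%MS ->
    2%:R * \tr (conjmx B c) = Complex (\tr (tproj x *m C)) (\tr (J x *m C)).
  move=> BT; have BQ : B *m Q = 2%:R *: B.
    have /submxP[D ->] : (B <= T)%MS by rewrite BT.
    by rewrite -mulmxA TQ scalemxAr.
  rewrite -mxtraceZ /conjmx scalemxAl scalemxAl -BQ -!mulmxA mxtrace_mulC.
  have -> : Q *m (c *m pinvmx B) *m B = Q *m c.
    rewrite mulmxA mulmxKpV // BT QC; exact: submx_trans (submxMl _ _) QT.
  by rewrite /Q cC cmx_mul !mulmx0 subr0 add0r cmx_trace.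
have := congr1 (@complex.Im R) (tr2 _ _ (eq_row_base T)).
rewrite mulr_natl mulr2n raddfD /= => <-; lra.
Qed.

Lemma trace_commutator x v w : tangent x v -> tangent x w ->
  complex.Im (trace_T01 J x (commutator_end (cov_end x v) (cov_end x w))) =
  - 2^-1 * trace_bracket (J x) (cov_end x v) (cov_end x w).
Proof.
move=> tv tw; have av := cov_end_anticommute tv; have aw := cov_end_anticommute tw.
move: (cov_end x v) (cov_end x w) av aw => A B av aw.
have comm (A' B' : 'M[R]_7) : A' *m J x = - (J x *m A') -> B' *m J x = - (J x *m B') ->
    B' *m A' *m J x = J x *m (B' *m A').
  by move=> hA hB; rewrite -mulmxA hA mulmxN [B' *m (_ *m A')]mulmxA hB mulNmx opprK mulmxA.
rewrite Im_trace_T01 /commutator_end; last first.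
  by rewrite mulmxBl mulmxBr (comm _ _ av aw) (comm _ _ aw av).
by rewrite -opprB mulmxN raddfN /= mulrN mulNr.
Qed.

End AlmostComplex.

(** * Pulling back to the cube *)

Section Pullback.
Context {R : realType}.
Implicit Types (y v : 'rV[R]_6).

Local Notation pt := (@collapse_pt R).

Lemma derive_collapse_tangent v y : tangent (pt y) ('D_v collapse y).
Proof.
have D := smooth_is_derive v (@smooth_collapse R) (I : setT y).
have := is_derive_bigsum (fun i => is_derive_mul (is_derive_entry ord0 i D)
  (is_derive_entry ord0 i D)).
rewrite (_ : (fun y => _) = cst (1 : R)); last by apply/funext => z; exact: collapse_dot.
move=> /(@derive_val _ _ _ _ _ _ _); rewrite derive_cst /tangent /= /dot => E.
have tw : 2 * (\sum_(i < 7) collapse y ord0 i * ('D_v collapse y) ord0 i) = 0.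
  by apply: etrans _ (esym E); rewrite mulr_sumr; apply: eq_bigr => i _; ring.
by lra.
Qed.

Lemma collapse_cover (W : normedModType R) (F : sphere6 R -> W) y : smooth F ->
  exists O U g, [/\ open O /\ O y, (forall z, O z -> U (collapse z)),
    open U, smooth_on U g & forall x : sphere6 R, U (val x) -> F x = g (val x)].
Proof.
move=> /(_ (pt y)) [U [g [oU Uy sg Fg]]]; exists (collapse @^-1` U), U, g; split => //.
split => //; apply: open_comp => // z _.
exact: differentiable_continuous (smooth_diff z (@smooth_collapse R)).
Qed.

Lemma smooth_pullback (a b : nat) (F : sphere6 R -> 'M[R]_(a, b)) :
  smooth F -> smooth_on setT (fun y => F (pt y)).
Proof.
move=> sF vs y _; have [N [U [g [[oN Ny] NU oU sg Fg]]]] := collapse_cover y sF.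
have sN : smooth_on N (fun y => F (pt y)).
  apply: (smooth_on_ext oN (f := fun y => g (collapse y))).
    by move=> z Nz; rewrite (Fg (pt z)) //; exact: NU.
  apply/(smooth_on_mxP oN) => i j.
  apply: (smooth_on_comp oN NU (g := fun z => g z i j)).
    exact: smooth_onS (@subsetT _ _) (@smooth_collapse R).
  exact: (smooth_on_mxP oU g).1.
exact: sN.
Qed.

Lemma derive_pullback (W : normedModType R) (F : sphere6 R -> W) v y : smooth F ->
  'D_v (fun y => F (pt y)) y = dS F (pt y) ('D_v collapse y).
Proof.
move=> sF; have [N [U [g [[oN Ny] NU oU sg Fg]]]] := collapse_cover y sF.
have Uy : U (val (pt y)) := NU y Ny.
rewrite (dS_local oU Uy Fg (smooth_on_diff sg Uy) (derive_collapse_tangent v y)).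
rewrite -(derive_comp_row _ (smooth_diff y (@smooth_collapse R)) (smooth_on_diff sg Uy)).
apply: near_eq_derive; apply: (filterS _ (open_nbhs_nbhs (conj oN Ny))) => z Nz.
by rewrite (Fg (pt z)) //; exact: NU.
Qed.

(** The derivative is injective, and the tangent space has dimension six. *)
Lemma derive_collapse_surj y (X : 'rV[R]_7) : (forall i, 0 < y ord0 i < 1) ->
  tangent (pt y) X -> exists w, 'D_w collapse y = X.
Proof.
move=> yin tX; have dc := smooth_diff y (@smooth_collapse R).
set M := jacobian collapse y.
have DE w : 'D_w collapse y = w *m M by exact: deriveEjacobian.
have freeM : row_free M.
  rewrite -kermx_eq0; apply/eqP/row_matrixP => i; rewrite row0.
  apply: (collapse_immersion yin); rewrite DE -row_mul mulmx_ker row0 //.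
have MN : (M <= kermx (collapse y)^T)%MS.
  apply/row_subP => i; apply/sub_kermxP; rewrite rowE -DE dot_scalar dotC.
  by have := derive_collapse_tangent (delta_mx 0 i) y; rewrite /tangent /= => ->; rewrite raddf0.
have c0 : collapse y != 0.
  apply/eqP => c0; have := collapse_dot y; rewrite c0 dotE mul0mx mxE => /eqP.
  by rewrite eq_sym oner_eq0.
have XM : (X <= M)%MS.
  have : (kermx (collapse y)^T <= M)%MS.
    have := mxrank_leqif_sup MN; case=> _ <-.
    rewrite mxrank_ker mxrank_tr rank_rV c0; move: freeM; rewrite /row_free => /eqP ->.
    by [].
  apply: submx_trans; apply/sub_kermxP; rewrite dot_scalar dotC.
  by move: tX; rewrite /tangent /= => ->; rewrite raddf0.
by have /submxP[w ->] := XM; exists w.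
Qed.

End Pullback.

Section ChernLinear.
Context {R : realType} {n : nat}.

Lemma chern_alg_linear (P K X1 Y1 X2 Y2 X Y : 'M[R]_n) (a : R) :
  chern_alg P K (a *: X1 + X2) (a *: Y1 + Y2) X Y =
  a * chern_alg P K X1 Y1 X Y + chern_alg P K X2 Y2 X Y.
Proof.
have lin A B1 B2 C : trace_bracket A (a *: B1 + B2) C = a * trace_bracket A B1 C + trace_bracket A B2 C :> R.
  have -> : trace_bracket A (a *: B1 + B2) C =
      \tr (A *m (a *: (B1 *m C - C *m B1) + (B2 *m C - C *m B2))).
    rewrite /trace_bracket mulmxDl [C *m (_ + _)]mulmxDr -scalemxAl -scalemxAr.
    by rewrite opprD addrACA scalerBr.
  by rewrite (mulmxDr A) -[A *m (a *: _)]scalemxAr mxtraceD mxtraceZ.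
by rewrite /chern_alg !lin; ring.
Qed.

Lemma trace_bracket_scale (A B C : 'M[R]_n) (a : R) :
  trace_bracket A (a *: B) (a *: C) = a ^+ 2 * trace_bracket A B C.
Proof.
rewrite /trace_bracket -!scalemxAl -!scalemxAr !scalerA -scalerBr -scalemxAr mxtraceZ -expr2.
by [].
Qed.

Lemma chern_form_sum (k : nat) (P K : 'rV[R]_k -> 'M[R]_n) (V W y : 'rV[R]_k) :
  smooth_on setT P -> smooth_on setT K ->
  chern_form P K V W y = \sum_(i < k) V ord0 i * chern_form P K (unit_vec R i) W y.
Proof.
move=> sP sK; pose f U := chern_form P K U W y.
have lin a U U' : f (a *: U + U') = a * f U + f U'.
  have dl (F : 'rV[R]_k -> 'M[R]_n) : smooth_on setT F ->
      'D_(a *: U + U') F y = a *: 'D_U F y + 'D_U' F y.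
    by move=> sF; rewrite !deriveE ?linearP //; exact: smooth_diff.
  by rewrite /f /chern_form (dl _ sP) (dl _ sK); exact: chern_alg_linear.
have f0 : f 0 = 0 by have := lin (-1) 0 0; rewrite scaler0 addr0 mulN1r addNr.
have fD : {morph f : U U' / U + U'}.
  by move=> U U'; have := lin 1 U U'; rewrite scale1r mul1r.
have fZ a U : f (a *: U) = a * f U by have := lin a U 0; rewrite !addr0 f0 addr0.
rewrite -/(f V) {1}[V]row_sum_delta (big_morph f fD f0).
by apply: eq_bigr => i _; rewrite fZ.
Qed.

End ChernLinear.

(** * The conclusion *)

Section Final.
Context {R : realType}.
Context (J : sphere6 R -> 'M[R]_7) (acsJ : almost_complex_structure J).
Implicit Types (x : sphere6 R).

Definition curvature_term x (X : 'rV[R]_7) : R :=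
  complex.Im (trace_T01 J x (commutator_end (cov_end J x X) (cov_end J x (X *m J x)))).

Lemma curvature_termE x X : tangent x X ->
  curvature_term x X = - 2^-1 * trace_bracket (J x) (cov_end J x X) (cov_end J x (X *m J x)).
Proof. by move=> tX; exact: (trace_commutator acsJ tX (acs_tangent_mul acsJ tX)). Qed.

(** Otherwise the pullback of the Chern form to the cube would pair each nonzero vector
    [V] nontrivially with the vector [W] that represents the image under [J] of the
    image of [V], contradicting [no_nondegenerate_closed_form]. *)
Lemma exists_large_curvature : exists x X, [/\ tangent x X, X <> 0 &
  2 * (dot X X + dot (X *m J x) (X *m J x)) <= curvature_term x X].
Proof.
have impossible (T s d : R) : T = - 2^-1 * s -> - 4 * d - s = 0 -> T < 2 * d -> False.
  by move=> -> *; lra.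
have sJ := acs_smooth acsJ.
apply: contrapT => none.
have small x X : tangent x X -> X <> 0 ->
    curvature_term x X < 2 * (dot X X + dot (X *m J x) (X *m J x)).
  by move=> tX X0; rewrite ltNge; apply/negP => le; apply: none; exists x, X.
pose P (y : 'rV[R]_6) := tproj (collapse_pt y).
pose K (y : 'rV[R]_6) := J (collapse_pt y).
have sP : smooth_on setT P := smooth_pullback (@smooth_tproj R).
have sK : smooth_on setT K := smooth_pullback sJ.
have PK y : complex_proj (P y) (K y) := acs_complex_proj acsJ (collapse_pt y).
pose B (i j : nat) : 'rV[R]_6 -> R :=
  chern_form P K (unit_vec R (inord i)) (unit_vec R (inord j)).
have DP v y : 'D_v P y = dS (@tproj R) (collapse_pt y) ('D_v collapse y).
  exact: derive_pullback (@smooth_tproj R).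
have DK v y : 'D_v K y = dS J (collapse_pt y) ('D_v collapse y).
  exact: derive_pullback sJ.
apply: (@no_nondegenerate_closed_form R B).
- by move=> i j; exact: (smooth_chern_form sP sK).
- by move=> i j y; exact: (chern_form_skew P K).
- by move=> i j k y; exact: (chern_form_closed sP sK PK).
- move=> y k _ yk i j.
  have z v : 'D_v P y = 0 /\ 'D_v K y = 0.
    by rewrite DP DK (derive_collapse_boundary v yk) /dS !derive0.
  rewrite /B /chern_form /chern_alg !(z _).1 !(z _).2 /trace_bracket.
  by rewrite !mul0mx !subrr !mulmx0 mxtrace0 !addr0.
- move=> y yin v Hv.
  pose V : 'rV[R]_6 := \row_i v i.
  have HVe (j : 'I_6) : chern_form P K V (unit_vec R j) y = 0.
    apply: etrans (chern_form_sum V _ y sP sK) (etrans _ (Hv j (ltn_ord j))).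
    by apply: eq_bigr => i _; rewrite mxE /B !inord_val.
  have HV (W : 'rV[R]_6) : chern_form P K V W y = 0.
    apply: etrans (chern_form_skew P K V W y) _.
    apply: etrans (congr1 -%R (chern_form_sum W V y sP sK)) _.
    rewrite big1 ?oppr0 // => j _.
    by rewrite (chern_form_skew P K (unit_vec R j) V y) HVe oppr0 mulr0.
  suff V0 : V = 0 by move=> i i6; move/rowP: V0 => /(_ (Ordinal i6)); rewrite !mxE.
  apply: (collapse_immersion yin); set X := 'D_V collapse y.
  apply: contrapT => X0.
  have tX : tangent (collapse_pt y) X := derive_collapse_tangent V y.
  have [W HW] := derive_collapse_surj yin (acs_tangent_mul acsJ tX).
  have zero : - 4 * (dot X X + dot (X *m J (collapse_pt y)) (X *m J (collapse_pt y))) -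
      trace_bracket (J (collapse_pt y)) (cov_end J (collapse_pt y) X)
        (cov_end J (collapse_pt y) (X *m J (collapse_pt y))) = 0.
    by have := HV W; rewrite /chern_form !DP !DK HW -/X; apply: etrans (esym (chern_alg_tame acsJ tX)).
  exact: impossible (curvature_termE tX) zero (small _ _ tX X0).
Qed.

Lemma curvature_termZ x (a : R) X : tangent x X ->
  curvature_term x (a *: X) = a ^+ 2 * curvature_term x X.
Proof.
move=> tX; have tJX := acs_tangent_mul acsJ tX.
have taX : tangent x (a *: X) by rewrite /tangent dotC dotZl dotC tX mulr0.
apply: etrans (curvature_termE taX) _; apply: etrans _ (congr1 (fun r => _ * r) (esym (curvature_termE tX))).
have -> : a *: X *m J x = a *: (X *m J x) by rewrite scalemxAl.
rewrite (cov_endZ acsJ a tX) (cov_endZ acsJ a tJX).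
by rewrite trace_bracket_scale mulrCA.
Qed.

End Final.

Theorem corollary4p6 (R : realType)
    (nabla : sphere6 R -> 'rV[R]_7 -> (sphere6 R -> 'rV[R]_7) -> 'rV[R]_7)
    (nablaLC : levi_civita nabla)
    (J : sphere6 R -> 'M[R]_7) (acsJ : almost_complex_structure J) :
  (exists (x : sphere6 R) (X : 'rV[R]_7),
     [/\ tangent x X, X <> 0 &
         2 * (enorm X ^+ 2 + enorm (X *m J x) ^+ 2) <=
         complex.Im (trace_T01 J x
           (commutator_end (nabla_end nabla J x X)
                           (nabla_end nabla J x (X *m J x))))]) /\
  (exists (x : sphere6 R) (X : 'rV[R]_7),
     [/\ tangent x X, enorm X = 1 &
         2 <=
         complex.Im (trace_T01 J x
           (commutator_end (nabla_end nabla J x X)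
                           (nabla_end nabla J x (X *m J x))))]).
Proof.
have E x X : tangent x X -> complex.Im (trace_T01 J x (commutator_end (nabla_end nabla J x X)
    (nabla_end nabla J x (X *m J x)))) = curvature_term J x X.
  move=> tX; rewrite (nabla_endE acsJ nablaLC tX).
  by rewrite (nabla_endE acsJ nablaLC (acs_tangent_mul acsJ tX)).
have [x [X [tX X0 HX]]] := exists_large_curvature acsJ.
have XX : 0 < dot X X.
  by rewrite lt_def dot_ge0 andbT; apply/eqP => /dot_self_eq0.
split; exists x.
  exists X; split; [exact: tX|exact: X0|].
  by rewrite (E x X tX) !enorm_sqr.
pose a := (enorm X)^-1.
have n0 : enorm X != 0 by rewrite -sqrf_eq0 enorm_sqr lt0r_neq0.
have a2 : a ^+ 2 * dot X X = 1 by rewrite /a exprVn enorm_sqr mulVf ?lt0r_neq0.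
have taX : tangent x (a *: X) by rewrite /tangent dotC dotZl dotC tX mulr0.
exists (a *: X); split; [exact: taX| |].
  by rewrite /enorm dotZl dotC dotZl mulrA -expr2 a2 sqrtr1.
rewrite (E x _ taX) (curvature_termZ acsJ a tX).
apply: le_trans (ler_wpM2l (sqr_ge0 a) HX).
rewrite mulrCA mulrDr a2 mulrDr mulr1 lerDl mulr_ge0 // mulr_ge0 ?sqr_ge0 //.
exact: dot_ge0.
Qed.
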